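(* Let $X\in\mathfrak{q}$ be such that $M=\operatorname{Ad}(H)X$ is a pseudo-Riemannian submanifold of a pseudo-hypersphere $\boldsymbol{S}=\{v\in\mathfrak{q}\mid B(v,v)=r\}$, $r>0$. Let $\xi=\xi_s+\xi_n$ be the Jordan-Chevalley decomposition of a normal vector $\xi\in T_X^\perp M$, and let $R$ be the restricted root system with respect to a Cartan subspace of $\mathfrak{q}$ containing $X$ and $\xi_s$. Then the spectrum of the complexified shape operator $A_\xi^{\mathbb{C}}$ is $$\operatorname{Spec}A_\xi^{\mathbb{C}}=\left\{-\frac{\alpha(\xi_s)}{\alpha(X)}\ \Big|\ \alpha\in R\text{ with }\alpha(X)\ne0\right\}.$$
   Context: $G$ is a connected semisimple noncompact real Lie group, $\sigma$ an involution of $G$, $H$ a closed subgroup with $(G_\sigma)_0\subset H\subset G_\sigma$ ($G_\sigma$ the fixed point group of $\sigma$). $\mathfrak{g}=\operatorname{Lie}(G)$, $\mathfrak{h}=\operatorname{Lie}(H)$ is the $(+1)$-eigenspace and $\mathfrak{q}$ the $(-1)$-eigenspace of the induced involution $\sigma$ of $\mathfrak{g}$; $B$ is the Killing form of $\mathfrak{g}$. $H$ acts on $\mathfrak{q}$ by $\operatorname{Ad}$, and $\boldsymbol{S}$ carries the metric induced by $B|_{\mathfrak{q}}$. ''Pseudo-Riemannian submanifold'' means nondegenerate induced metric. $T_X^\perp M=\{\xi\in\mathfrak{q}\mid[\xi,X]=0,\ B(\xi,X)=0\}$ is the normal space of $M$ in $\boldsymbol{S}$ at $X$; $A_\xi$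 is the shape operator of $M\hookrightarrow\boldsymbol{S}$ in direction $\xi$, normalized by $A_\xi v=-(\nabla_v\xi)^{\top}$, and $A_\xi^{\mathbb{C}}$ its complex-linear extension to $(T_XM)^{\mathbb{C}}$. The Jordan-Chevalley decomposition of $\xi\in\mathfrak{g}$ is the one induced by that of $\operatorname{ad}(\xi)$ ($\xi_s$ semisimple part, $\xi_n$ nilpotent part). A Cartan subspace of $\mathfrak{q}$ is a maximal abelian subspace of $\mathfrak{q}$ consisting of semisimple elements ($\operatorname{ad}$-diagonalizable over $\mathbb{C}$). For a Cartan subspace $\mathfrak{a}$, the restricted root system is $R=\{\alpha\in(\mathfrak{a}^{\mathbb{C}})^*\setminus\{0\}\mid\mathfrak{q}^{\mathbb{C}}_\alpha\ne\{0\}\}$ with $\mathfrak{q}^{\mathbb{C}}_\alpha=\{Y\in\mathfrak{q}^{\mathbb{C}}\mid\operatorname{ad}(A)^2Y=\alpha(A)^2Y\ \forall A\in\mathfrak{a}^{\mathbb{C}}\}$. *)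

(* Defs.v *)
From HB Require Import structures.
From mathcomp Require Import all_boot all_order all_algebra.
From mathcomp Require Import all_classical all_reals all_analysis.
From mathcomp Require Import complex.

Set Implicit Arguments.
Unset Strict Implicit.
Unset Printing Implicit Defensive.

Import Order.TTheory GRing.Theory Num.Theory.
Import numFieldNormedType.Exports.

Local Open Scope classical_set_scope.
Local Open Scope ring_scope.
Local Open Scope complex_scope.

(** * Smooth maps between normed spaces *)

Fixpoint Ck_on {R : realType} {V W : normedModType R} (U : set V) (k : nat)
    (f : V -> W) : Prop :=
  (forall x, U x -> {for x, continuous f}) /\
  if k is k'.+1 then
    forall v, (forall x, U x -> derivable f x v) /\
              Ck_on U k' (fun x => 'D_v f x)
  else True.

(** C^oo on an open subset [U] of a finite-dimensional space: the iterated
    directional derivatives of all orders exist and are continuous on [U]. *)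
Definition smooth_on {R : realType} {V W : normedModType R} (U : set V)
    (f : V -> W) : Prop := forall k, Ck_on U k f.

(** * Lie groups *)

(** No compatibility between the two structures is required here; it is part of
    [lie_group] below. *)
#[short(type="topGroupType")]
HB.structure Definition TopGroup := {G of Group G & Topological G}.

Record chart (R : realType) (n : nat) (T : topologicalType) := Chart {
  chart_dom : set T;
  chart_map : T -> 'rV[R]_n;
  chart_inv : 'rV[R]_n -> T }.

Section LieGroup.
Context {R : realType} {n : nat} {G : topGroupType}.
Implicit Types (c d : chart R n G) (atlas : set (chart R n G)).

Definition chart_codom c : set 'rV[R]_n := chart_map c @` chart_dom c.

(** [chart_map c] is a homeomorphism from the open set [chart_dom c] onto an
    open subset of R^n, with inverse [chart_inv c]; values outside these sets
    are irrelevant. *)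
Definition is_chart c : Prop :=
  [/\ open (chart_dom c), open (chart_codom c),
      forall g, chart_dom c g -> chart_inv c (chart_map c g) = g,
      forall g, chart_dom c g -> {for g, continuous (chart_map c)} &
      forall u, chart_codom c u -> {for u, continuous (chart_inv c)}].

Definition smooth_map atlas (f : G -> G) : Prop :=
  continuous f /\
  forall c d, atlas c -> atlas d ->
    smooth_on [set u | chart_codom c u /\ chart_dom d (f (chart_inv c u))]
              (fun u => chart_map d (f (chart_inv c u))).

Definition smooth_map2 atlas (f : G -> G -> G) : Prop :=
  continuous (fun p : G * G => f p.1 p.2) /\
  forall c1 c2 d, atlas c1 -> atlas c2 -> atlas d ->
    smooth_on
      [set p : 'rV[R]_n * 'rV[R]_n |
        [/\ chart_codom c1 p.1, chart_codom c2 p.2 &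
            chart_dom d (f (chart_inv c1 p.1) (chart_inv c2 p.2))]]
      (fun p => chart_map d (f (chart_inv c1 p.1) (chart_inv c2 p.2))).

(** Smoothness of the identity says that the chart transitions are smooth. *)
Definition lie_group atlas : Prop :=
  [/\ hausdorff_space G /\ @second_countable G,
      forall c, atlas c -> is_chart c,
      forall g, exists2 c, atlas c & chart_dom c g,
      smooth_map atlas idfun &
      smooth_map2 atlas (fun g h => (g * h)%g) /\
      smooth_map atlas (fun g => (g^-1)%g)].

Definition lie_involution atlas (sigma : G -> G) : Prop :=
  [/\ smooth_map atlas sigma,
      forall g h, sigma (g * h)%g = (sigma g * sigma h)%g &
      involutive sigma].

Definition closed_subgroup (H : set G) : Prop :=
  [/\ closed H, H 1%g, forall g h, H g -> H h -> H (g * h)%g &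
      forall g, H g -> H (g^-1)%g].

Definition fixed_points (sigma : G -> G) : set G := [set g | sigma g = g].

(** * The Lie algebra, in the coordinates of a chart around the identity

    The tangent space of [G] at 1 is identified with R^n through the
    differential at 1 of [chart_map e], where [e] is a chart with
    [chart_dom e 1]. *)

Section LieAlgebra.
Variable e : chart R n G.
Local Notation g0 := 'rV[R]_n.
Implicit Types (X Y Z : g0).

(** Differential at 1 of a map fixing 1. *)
Definition diff1 (f : G -> G) Y : g0 :=
  'D_Y (fun u => chart_map e (f (chart_inv e u))) (chart_map e 1%g).

Definition Ad (g : G) : g0 -> g0 := diff1 (fun h => (g * h * g^-1)%g).

(** [X, Y] = ad(X) Y, where ad is the differential of Ad at 1. *)
Definition bracket X Y : g0 :=
  'D_X (fun u => Ad (chart_inv e u) Y) (chart_map e 1%g).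

Definition ad_mx X : 'M[R]_n := lin1_mx (bracket X).

Definition killing X Y : R := \tr (ad_mx X *m ad_mx Y).

Definition semisimple_algebra : Prop :=
  forall X, (forall Y, killing X Y = 0) -> X = 0.

(** Over the complex numbers. *)
Definition semisimple_elt X : Prop :=
  diagonalizable (map_mx (real_complex R) (ad_mx X)).

Definition nilpotent_elt X : Prop := exists k : nat, ad_mx X ^+ k = 0.

Definition jordan_chevalley X Xs Xn : Prop :=
  [/\ X = Xs + Xn, semisimple_elt Xs, nilpotent_elt Xn & bracket Xs Xn = 0].

(** ** Complexification; elements of g^C are written x + i y *)

Definition cplx (x y : g0) : 'rV[R[i]]_n := \row_j (x 0 j +i* y 0 j).
Definition re_part (z : 'rV[R[i]]_n) : g0 := map_mx (@complex.Re R) z.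
Definition im_part (z : 'rV[R[i]]_n) : g0 := map_mx (@complex.Im R) z.

Definition cplx_set (S : set g0) : set 'rV[R[i]]_n :=
  [set z | S (re_part z) /\ S (im_part z)].

Definition cplx_op (A : g0 -> g0) (z : 'rV[R[i]]_n) : 'rV[R[i]]_n :=
  cplx (A (re_part z)) (A (im_part z)).

Definition cplx_bracket (x y : 'rV[R[i]]_n) : 'rV[R[i]]_n :=
  cplx (bracket (re_part x) (re_part y) - bracket (im_part x) (im_part y))
       (bracket (re_part x) (im_part y) + bracket (im_part x) (re_part y)).

(** * Symmetric pairs *)

Variable sigma : G -> G.

(** The +1 eigenspace is the Lie algebra of any [H] lying between the fixed
    point group of [sigma] and its identity component. *)
Definition hh : set g0 := [set Z | diff1 sigma Z = Z].
Definition qq : set g0 := [set Z | diff1 sigma Z = - Z].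

Definition abelian_semisimple (a : {vspace g0}) : Prop :=
  [/\ forall A, A \in a -> qq A,
      forall A B, A \in a -> B \in a -> bracket A B = 0 &
      forall A, A \in a -> semisimple_elt A].

Definition cartan_subspace (a : {vspace g0}) : Prop :=
  abelian_semisimple a /\
  forall b : {vspace g0}, abelian_semisimple b -> (a <= b)%VS -> b = a.

Definition cplx_vspace (a : {vspace g0}) : set 'rV[R[i]]_n :=
  cplx_set [set A | A \in a].

Definition root_space (a : {vspace g0}) (alpha : 'rV[R[i]]_n -> R[i]) :
    set 'rV[R[i]]_n :=
  [set Y | cplx_set qq Y /\
    forall A, cplx_vspace a A ->
      cplx_bracket A (cplx_bracket A Y) = alpha A ^+ 2 *: Y].

(** Linear forms on a^C are represented by functions on g^C whose values
    outside a^C are irrelevant. *)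
Definition restricted_root (a : {vspace g0}) (alpha : 'rV[R[i]]_n -> R[i]) :
    Prop :=
  [/\ forall (k : R[i]) A B, cplx_vspace a A -> cplx_vspace a B ->
        alpha (k *: A + B) = k * alpha A + alpha B,
      exists2 A, cplx_vspace a A & alpha A <> 0 &
      exists2 Y, root_space a alpha Y & Y <> 0].

(** * Orbits in q *)

Variable H : set G.

Definition ad_orbit (X : g0) : set g0 := [set Ad g X | g in H].

Definition pseudo_sphere (r : R) : set g0 :=
  [set v | qq v /\ killing v v = r].

(** Image of the Lie algebra of [H] under the differential of the orbit map
    [g |-> Ad g p]. *)
Definition orbit_tangent (p : g0) : set g0 := [set bracket Z p | Z in hh].

Definition orbit_normal (p : g0) : set g0 :=
  [set xi | [/\ qq xi, bracket xi p = 0 & killing xi p = 0]].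

Definition pseudo_riemannian_orbit (X : g0) : Prop :=
  forall p, ad_orbit X p -> forall v, orbit_tangent p v ->
    (forall w, orbit_tangent p w -> killing v w = 0) -> v = 0.

(** Levi-Civita derivative in the pseudo-sphere through [p] of a field along a
    curve through [p] whose derivative in the flat space q is [D]. *)
Definition sphere_proj (p D : g0) : g0 := D - (killing D p / killing p p) *: p.

(** [w = - (nabla_v nu)^T] for a curve [gamma] in the orbit of [X] with
    velocity [v] at [X] and a normal field [nu] along [gamma] with value [xi] at
    [X]; the last two conditions say that [- w] is the tangential component of
    [nabla_v nu].  Only first derivatives at 0 enter, so no higher regularity of
    [gamma] and [nu] is asked for. *)
Definition shape_rel (X xi v w : g0) : Prop :=
  exists (gamma nu : R -> g0) (D : g0),
    [/\ gamma 0 = X /\ is_derive (0 : R) (1 : R) gamma v,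
        nu 0 = xi /\ is_derive (0 : R) (1 : R) nu D,
        \forall t \near (0 : R),
          ad_orbit X (gamma t) /\ orbit_normal (gamma t) (nu t),
        orbit_tangent X w &
        orbit_normal X (sphere_proj X D + w)].

(** The shape operator in direction [xi], meaningful on [orbit_tangent X]. *)
Definition shape_op (X xi v : g0) : g0 := xget 0 [set w | shape_rel X xi v w].

Definition shape_spectrum (X xi : g0) : set R[i] :=
  [set lambda | exists2 z : 'rV[R[i]]_n,
     cplx_set (orbit_tangent X) z /\ z <> 0 &
     cplx_op (shape_op X xi) z = lambda *: z].

End LieAlgebra.
End LieGroup.

(* Main.v *)
Require Import Defs.
From HB Require Import structures.
From mathcomp Require Import all_boot all_order all_algebra.
From mathcomp Require Import all_classical all_reals all_analysis.
From mathcomp Require Import complex ring lra.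

(** The tangent vectors of the orbit at [X] are the [[Z, X]] with [Z] in [h].  A
    curve [g] in [H] through 1 with velocity [Z] gives the curve [Ad (g t) X] in
    the orbit and the normal field [Ad (g t) xi] along it; as [[nu, gamma] = 0]
    for a normal field [nu], differentiating shows that the shape operator [S]
    satisfies [[S v, X] = [xi, v]], and nondegeneracy of the orbit makes this a
    characterization of [S v] among tangent vectors.  Hence [z] is an eigenvector
    of the complexified shape operator for [l] iff [z] is a nonzero complex
    tangent vector killed by [l ad X + ad xi].  As [ad xi_n] is nilpotent and
    commutes with [ad X] and [ad xi_s], it can be replaced by 0 up to moving [z];
    then [z] is tested against the common eigenvectors of [ad a].

    Curves in [H] come from the fixed points of [sigma] near 1: in a chart,
    [u |-> (u + dsigma (sigma u)) / 2] conjugates [sigma] to its differential, and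
    is inverted by the contraction principle, so no exponential map is needed.
    Antisymmetry of the bracket is read off from the Jacobi identity: the latter
    gives [ad [X, Y] = - ad [Y, X]], and [ad] is injective by semisimplicity. *)

Set Implicit Arguments.
Unset Strict Implicit.
Unset Printing Implicit Defensive.

Import Order.TTheory GRing.Theory Num.Theory.
Import numFieldNormedType.Exports.

Local Open Scope classical_set_scope.
Local Open Scope ring_scope.
Local Open Scope complex_scope.

(** * Strict differentiability of C^1 maps *)

Section Lines.
Context {R : realType} {V W : normedModType R}.

Lemma is_derive_line (f : V -> W) (x v : V) (t : R) :
  derivable f (t *: v + x) v ->
  is_derive t 1 (fun s : R => f (s *: v + x)) ('D_v f (t *: v + x)).
Proof.
have E : (fun h : R => h^-1 *: (((fun s : R => f (s *: v + x)) \o shift t)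
       (h *: (1 : R)) - f (t *: v + x))) =
   (fun h => h^-1 *: ((f \o shift (t *: v + x)) (h *: v) - f (t *: v + x))).
  apply/funext => h /=; congr (_ *: (f _ - _)).
  by rewrite [_%:A]mulr1 scalerDl addrA.
by move=> df; split; rewrite /derivable /derive E.
Qed.

(** Only derivability in the direction [v] is assumed, so [k] is extracted by composing the
    restriction of [f] to the line with multiplication by [k]; this covers [k = 0] as well. *)
Lemma is_derive_sub (f : V -> W) (x v : V) (t k : R) :
  derivable f (t *: (k *: v) + x) v ->
  is_derive t 1 (fun s : R => f (s *: (k *: v) + x))
    (k *: 'D_v f (t *: (k *: v) + x)).
Proof.
rewrite scalerA => /is_derive_line[/derivable1_diffP d1 d2].
have -> : (fun s : R => f (s *: (k *: v) + x)) =
   (fun s : R => f (s *: v + x)) \o *%R^~ k.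
  by apply/funext => s /=; rewrite scalerA.
have dk : is_derive t 1 ( *%R^~ k : R -> R) k.
  have -> : ( *%R^~ k : R -> R) = k \*: id.
    by apply/funext => s /=; rewrite mulrC.
  by apply: is_derive_eq; rewrite [_ *: _]mulr1.
have [/derivable1_diffP dk1 dk2] := dk.
split; first by apply/derivable1_diffP/differentiable_comp.
rewrite deriveE; last exact: differentiable_comp.
rewrite diff_comp//=.
have -> : 'd ( *%R^~ k : R -> R) t 1 = k by rewrite -(deriveE _ dk1).
set F := fun s : R => _ in d1 d2 *.
have -> : 'd F (t * k) k = k *: 'd F (t * k) 1 by rewrite -linearZ/= [_ *: _]mulr1.
by rewrite -deriveE// d2.
Qed.
End Lines.

Section Increments.
Context {R : realType} {V : normedModType R}.

(** The mean value theorem on [0, 1]. Writing the step as [a *: b] keeps the direction of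
    differentiation equal to [b], whatever the size and sign of [a]. *)
Lemma mean_value_increment (f : V -> R) (y b : V) (a c eps : R) :
  (forall t : R, 0 <= t <= 1 ->
     derivable f (t *: (a *: b) + y) b /\
     `|'D_b f (t *: (a *: b) + y) - c| <= eps) ->
  `|f (a *: b + y) - f y - a * c| <= eps * `|a|.
Proof.
move=> H.
pose g (t : R) : R := f (t *: (a *: b) + y).
pose dg (t : R) : R := a * 'D_b f (t *: (a *: b) + y).
have gd (t : R) : 0 <= t <= 1 -> is_derive t 1 g (dg t).
  by move=> t01; have [fd _] := H t t01; exact: is_derive_sub.
have [||t t01] := @MVT_segment R g dg 0 1 ler01.
- by move=> t; rewrite in_itv/= => /andP[/ltW t0 /ltW t1]; apply/gd/andP.
- apply: derivable_within_continuous => t; rewrite in_itv/= => t01.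
  by have [] := gd t t01.
rewrite /g scale1r scale0r add0r subr0 mulr1 => ->.
rewrite /dg -mulrBr normrM mulrC ler_wpM2r//.
by move: t01; rewrite in_itv/= => /H[].
Qed.

(* Move from [y] to [y + \sum_i a i *: b i] one coordinate at a time. *)
Lemma coordinate_increment (I : Type) (s : seq I) (b : I -> V) (f : V -> R)
    (x : V) (rho eps : R) :
  (forall i z, `|z - x| < rho ->
     derivable f z (b i) /\ `|'D_(b i) f z - 'D_(b i) f x| <= eps) ->
  forall (a : I -> R) (y : V),
    `|y - x| + \sum_(i <- s) `|a i *: b i| < rho ->
    `|f (\sum_(i <- s) a i *: b i + y) - f y - \sum_(i <- s) a i * 'D_(b i) f x|
      <= eps * \sum_(i <- s) `|a i|.
Proof.
move=> H a; elim: s => [|i s IH] y; first by rewrite !big_nil add0r !subrr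
  normr0 mulr0.
rewrite !big_cons => Hy.
set S := \sum_(_ <- _) _ *: _; set T := \sum_(_ <- _) _ * _.
have /IH : `|a i *: b i + y - x| + \sum_(j <- s) `|a j *: b j| < rho.
  by have := ler_normD (a i *: b i) (y - x); rewrite addrA; lra.
have := @mean_value_increment f y (b i) (a i) ('D_(b i) f x) eps.
have ball_t (t : R) : 0 <= t <= 1 -> `|t *: (a i *: b i) + y - x| < rho.
  move=> /andP[t0 t1]; apply: le_lt_trans Hy.
  rewrite -addrA (le_trans (ler_normD _ _))// [leLHS]addrC lerD2l normrZ
    ger0_norm//.
  by rewrite ler_wpDr ?sumr_ge0// ler_piMl.
move=> /(_ (fun t t01 => H i _ (ball_t t t01))) H1 H2.
have -> : f (a i *: b i + S + y) - f y - (a i * 'D_(b i) f x + T) =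
    (f (a i *: b i + y) - f y - a i * 'D_(b i) f x) +
    (f (S + (a i *: b i + y)) - f (a i *: b i + y) - T).
  by rewrite [a i *: b i + S]addrC -[S + _ + y]addrA; ring.
rewrite mulrDr.
by rewrite (le_trans (ler_normD _ _))// lerD.
Qed.
End Increments.

Lemma mx_norm_le {R : realType} {m n} (A : 'M[R]_(m, n)) (e : R) :
  0 <= e -> (forall i j, `|A i j| <= e) -> `|A| <= e.
Proof.
move=> e0 H; rewrite [leLHS]/Num.Def.normr/= mx_normrE bigmax_le//=.
Qed.

Lemma coord_norm_le {R : realType} {m n} (A : 'M[R]_(m, n)) i j :
  `|A i j| <= `|A|.
Proof.
rewrite [leRHS]/Num.Def.normr/= mx_normrE.
exact: (le_bigmax _ (fun ij => `|A ij.1 ij.2|) (i, j)).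
Qed.

Section StrictDifferentiability.
Context {R : realType} {V : normedModType R}.

(** A finite family of vectors with coordinate functions bounded by the norm: the structure shared
    by row vectors and pairs of row vectors, so that maps on one chart and on a product of two
    charts are treated at once. *)
Definition frame (I : finType) (b : I -> V) (c : I -> V -> R) : Prop :=
  [/\ forall i k u v, c i (k *: u + v) = k * c i u + c i v,
      forall v, \sum_i c i v *: b i = v,
      forall i, `|b i| <= 1 & forall i v, `|c i v| <= `|v|].

Section Frame.
Context {I : finType} {b : I -> V} {c : I -> V -> R}.
Hypothesis bc : frame b c.
Context {k : nat} (f : V -> 'rV[R]_k) (U : set V) (x : V).
Hypotheses (xU : nbhs x U) (fC1 : Ck_on U 1 f).

Let L v := \sum_i c i v *: 'D_(b i) f x.

(** Near [x] the partial derivatives are uniformly close to their values at [x], so coordinatewise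
    increments are close to [L]. The bound is uniform in both endpoints, as the contraction argument
    for the involution requires. *)
Lemma C1_strict_frame (eps : R) : 0 < eps ->
  exists2 rho : R, 0 < rho & forall y z, `|y - x| < rho -> `|z - x| < rho ->
    `|f z - f y - L (z - y)| <= eps * `|z - y|.
Proof.
move=> eps0; have [clin cb b1 c1] := bc.
have [fcont fd] := fC1.
have Ux : U x := nbhs_singleton xU.
pose N : R := #|I|%:R; have N0 : 0 <= N by rewrite ler0n.
(* The coordinates of [z - y] have absolute sum at most [N * |z - y|], which multiplies the error
   [e']; [N + 1] is nonzero even for an empty frame. *)
pose e' := eps / (N + 1).
have e'0 : 0 < e' by rewrite divr_gt0// ltr_wpDl.
have : \forall z \near x, U z /\ forall i, `|'D_(b i) f z - 'D_(b i) f x| <= e'.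
  near=> z; split; first by near: z.
  near: z; apply: filter_forall => i.
  have [_ [/(_ _ Ux) ctn _]] := fd (b i).
  move/cvgrPdist_le : ctn => /(_ _ e'0); apply: filterS => z.
  by rewrite (distrC ('D_(b i) f x)).
move=> /nbhs_ballP[r /= r0 Hr].
(* The path from [y] to [z] along the coordinate directions has length at most [N * |z - y|]; with
   this radius it stays in the ball of radius [r]. *)
exists (r / (2 + 2 * N)); first by rewrite divr_gt0// ltr_wpDr ?mulr_ge0.
move=> y z; rewrite !ltr_pdivlMr ?ltr_wpDr ?mulr_ge0// => yr zr.
have sum_le : \sum_i `|c i (z - y)| <= N * `|z - y|.
  rewrite (le_trans (ler_sum _ (fun i _ => c1 i (z - y))))//.
  by rewrite sumr_const mulr_natl.
apply: mx_norm_le => [|i0 j]; first by rewrite mulr_ge0// ltW.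
rewrite ord1 !mxE summxE.
have H i w : `|w - x| < r -> derivable (fun u => f u 0 j) w (b i) /\
   'D_(b i) (fun u => f u 0 j) w = 'D_(b i) f w 0 j /\
   `|'D_(b i) (fun u => f u 0 j) w - 'D_(b i) (fun u => f u 0 j) x| <= e'.
  move=> wr; have [Uw Hw] : U w /\ forall i, `|'D_(b i) f w - 'D_(b i) f x| <= e'.
    by apply: Hr; rewrite -ball_normE/= distrC.
  have d w' : U w' -> derivable (fun u => f u 0 j) w' (b i) /\
      'D_(b i) (fun u => f u 0 j) w' = 'D_(b i) f w' 0 j.
    move=> Uw'; have fw' : derivable f w' (b i) by have [+ _] := fd (b i); apply.
    split; first by move/derivable_mxP: fw'.
    by rewrite derive_mx// mxE.
  have [dw ew] := d _ Uw; have [dx ex] := d _ Ux.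
  split=> //; split=> //; rewrite ew ex.
  by apply: le_trans (Hw i); have := coord_norm_le ('D_(b i) f w - 'D_(b i) f x)
    0 j; rewrite !mxE.
have := @coordinate_increment R V I (index_enum I) b (fun u => f u 0 j) x r e'
   (fun i w wr => conj (H i w wr).1 (H i w wr).2.2) (fun i => c i (z - y)) y.
rewrite cb subrK.
have -> : \sum_i c i (z - y) * 'D_(b i) (fun u => f u 0 j) x =
    \sum_i (c i (z - y) *: 'D_(b i) f x) 0 j.
  by apply: eq_bigr => i _; rewrite mxE (H i x _).2.1// subrr normr0.
move=> HH; apply: (le_trans (HH _)).
  have bl : \sum_i `|c i (z - y) *: b i| <= N * `|z - y|.
    apply: le_trans sum_le; apply: ler_sum => i _.
    by rewrite normrZ ler_piMr.
  have : `|z - y| <= `|z - x| + `|y - x| by rewrite (distrC y) ler_distD.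
  move=> /(ler_wpM2l N0) zy; have := normr_ge0 (z - x); lra.
rewrite (le_trans (ler_wpM2l (ltW e'0) sum_le))// mulrA ler_wpM2r//.
by rewrite /e' mulrAC ler_pdivrMr ?ltr_wpDl// ler_wpM2l ?lerDl// ltW.
Unshelve. all: by end_near. Qed.

Lemma frame_linear_continuous {W : normedModType R} (g : {linear V -> W}) :
  continuous g.
Proof.
apply/linear_bounded_continuous/linear_boundedP.
have [clin cb b1 c1] := bc.
near=> M => v; rewrite -{1}(cb v) linear_sum/=.
apply: (@le_trans _ _ (\sum_i `|g (b i)| * `|v|)); last first.
  rewrite -mulr_suml ler_wpM2r//; near: M;
  exact: (nbhs_pinfty_ge (num_real _)).
rewrite (le_trans (ler_norm_sum _ _ _))// ler_sum// => i _.
by rewrite linearZ/= normrZ mulrC ler_wpM2l.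
Unshelve. all: by end_near. Qed.

(** The strict estimate with [y = x] shows that [L] is the differential at [x]; the estimate is then
    restated with directional derivatives, free of the frame. *)
Lemma C1_frame_diff :
  differentiable f x /\ forall eps : R, 0 < eps ->
    exists2 rho : R, 0 < rho & forall y z, `|y - x| < rho -> `|z - x| < rho ->
    `|f z - f y - 'D_(z - y) f x| <= eps * `|z - y|.
Proof.
have [clin _ _ _] := bc.
have Llin : linear L.
  move=> a u v; rewrite /L scaler_sumr -big_split/=; apply: eq_bigr => i _.
  by rewrite clin scalerDl scalerA.
pose LM := GRing.isLinear.Build _ _ _ _ _ Llin.
pose LL : {linear V -> 'rV[R]_k} := HB.pack L LM.
have LC : continuous LL := frame_linear_continuous (g:=LL).
have E : f \o shift x = cst (f x) + LL +o_ 0 id.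
  apply/eqaddoP => eps eps0.
  have [rho rho0 Hrho] := C1_strict_frame eps0.
  apply/nbhs_ballP; exists rho => //= h; rewrite -ball_normE/= sub0r normrN => hr.
  have := Hrho x (h + x); rewrite subrr normr0 addrK => /(_ rho0 hr).
  by rewrite -[(_ + _ : V -> _) _]/(_ + _) opprD addrA.
have dL : 'd f x = LL :> (V -> _) by exact: diff_unique.
have df : differentiable f x by apply/diff_locallyP; rewrite dL.
split=> // eps eps0; have [rho rho0 Hrho] := C1_strict_frame eps0.
by exists rho => // y z yr zr; rewrite deriveE// dL; exact: Hrho.
Qed.
End Frame.
End StrictDifferentiability.

Section Frames.
Context {R : realType} {n : nat}.

Lemma frame_rV :
  frame (fun i : 'I_n => delta_mx 0 i : 'rV[R]_n) (fun i v => v 0 i).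
Proof.
split=> [i k u v|v|i|i v]; first by rewrite !mxE.
- by rewrite [RHS]row_sum_delta.
- apply: mx_norm_le => // j l; rewrite mxE.
  by case: (_ && _); rewrite ?normr1 ?normr0.
- exact: coord_norm_le.
Qed.

Definition pair_basis (i : 'I_n + 'I_n) : 'rV[R]_n * 'rV[R]_n :=
  match i with inl j => (delta_mx 0 j, 0) | inr j => (0, delta_mx 0 j) end.
Definition pair_coord (i : 'I_n + 'I_n) (p : 'rV[R]_n * 'rV[R]_n) : R :=
  match i with inl j => p.1 0 j | inr j => p.2 0 j end.

Lemma frame_pair : frame pair_basis pair_coord.
Proof.
have [l1 s1 b1 c1] := frame_rV.
split=> [[i|i] k u v|[v w]|[i|i]|[i|i] v] /=; rewrite ?mxE//.
- rewrite big_sumType/=; congr pair.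
    rewrite !(big_morph fst (id1 := 0) (op1 := +%R))//= [X in _ + X]big1 ?addr0//.
    by move=> i _; rewrite /= scaler0.
  rewrite !(big_morph snd (id1 := 0) (op1 := +%R))//= [X in X + _]big1 ?add0r//.
  by move=> i _; rewrite /= scaler0.
- by rewrite prod_normE/= normr0 ge_max b1 ler01.
- by rewrite prod_normE/= normr0 ge_max b1 ler01.
- by rewrite prod_normE le_max c1.
- by rewrite prod_normE le_max c1 orbT.
Qed.
End Frames.

(** * Maps between charts *)

Lemma differentiable_rowP {R : realType} {V : normedModType R} {k : nat}
    (f : V -> 'rV[R]_k) (x : V) :
  (forall j, differentiable (fun y => f y 0 j : R) x) -> differentiable f x.
Proof.
move=> fd.
have -> : f = \sum_(j < k) (fun y => f y 0 j *: delta_mx 0 j).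
  by apply/funext => y; rewrite fct_sumE -row_sum_delta.
by apply: differentiable_sum => j; exact: differentiableZl.
Qed.

Lemma near_continuous_at {T U : topologicalType} (f : T -> U) (x : T) (A : set U) :
  {for x, continuous f} -> open A -> A (f x) -> \forall y \near x, A (f y).
Proof. by move=> fc oA Afx; apply: fc; exact: open_nbhs_nbhs. Qed.

Section Charts.
Context {R : realType} {n : nat} {G : topGroupType} {atlas : set (chart R n G)}.
Hypothesis lieG : lie_group atlas.
Implicit Types (c d : chart R n G) (g h : G).

Let chartP c : atlas c -> is_chart c.
Proof. by have [_ + _ _ _] := lieG; apply. Qed.

Lemma chart_invK c g : atlas c -> chart_dom c g ->
  chart_inv c (chart_map c g) = g.
Proof. by move=> /chartP[_ _ + _ _] => H /H. Qed.

Lemma chart_dom_inv c u : atlas c -> chart_codom c u -> chart_dom c (chart_inv c u).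
Proof. by move=> ac [g cg <-]; rewrite chart_invK. Qed.

Lemma chart_mapK c u : atlas c -> chart_codom c u ->
  chart_map c (chart_inv c u) = u.
Proof. by move=> ac [g cg <-]; rewrite chart_invK. Qed.

Lemma chart_inv_continuous c g : atlas c -> chart_dom c g ->
  {for chart_map c g, continuous (chart_inv c)}.
Proof. by move=> /chartP[_ _ _ _ H] cg; apply: H; exists g. Qed.

Lemma chart_dom_open c : atlas c -> open (chart_dom c).
Proof. by move=> /chartP[]. Qed.

Lemma near_codom c g : atlas c -> chart_dom c g ->
  \forall u \near chart_map c g, chart_codom c u.
Proof.
by move=> ac cg; have [_ o _ _ _] := chartP ac; apply: open_nbhs_nbhs; split=>
  //; exists g.
Qed.

Lemma mulg_continuous : continuous (fun p : G * G => (p.1 * p.2)%g).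
Proof. by have [_ _ _ _ [[]]] := lieG. Qed.

Lemma mulg_continuous_at {T : topologicalType} (f1 f2 : T -> G) (x : T) :
  {for x, continuous f1} -> {for x, continuous f2} ->
  {for x, continuous (fun y => f1 y * f2 y)%g}.
Proof.
move=> c1 c2; apply: (@continuous_comp _ _ _ (fun y => (f1 y, f2 y))
  (fun p : G * G => (p.1 * p.2)%g)); last exact: mulg_continuous.
exact: cvg_pair.
Qed.

(** Three independent charts are allowed, because conjugation by an element far from 1 multiplies
    points that need not lie in one chart domain. *)
Definition mul_chart c1 c2 d (p : 'rV[R]_n * 'rV[R]_n) : 'rV[R]_n :=
  chart_map d (chart_inv c1 p.1 * chart_inv c2 p.2)%g.

Definition mul_chart_dom c1 c2 d := [set p : 'rV[R]_n * 'rV[R]_n |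
  [/\ chart_codom c1 p.1, chart_codom c2 p.2 &
      chart_dom d (chart_inv c1 p.1 * chart_inv c2 p.2)%g]].

Lemma nbhs_mul_chart_dom c1 c2 d g h : atlas c1 -> atlas c2 -> atlas d ->
  chart_dom c1 g -> chart_dom c2 h -> chart_dom d (g * h)%g ->
  nbhs (chart_map c1 g, chart_map c2 h) (mul_chart_dom c1 c2 d).
Proof.
move=> a1 a2 ad dg dh dgh.
have H : \forall p \near (chart_map c1 g, chart_map c2 h),
   chart_dom d (chart_inv c1 p.1 * chart_inv c2 p.2)%g.
  apply: (@near_continuous_at _ _ (fun p => (chart_inv c1 p.1 * chart_inv c2
    p.2)%g)).
  - apply: mulg_continuous_at.
      apply: (@continuous_comp _ _ _ fst); first exact: cvg_fst.
      exact: chart_inv_continuous.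
    apply: (@continuous_comp _ _ _ snd); first exact: cvg_snd.
    exact: chart_inv_continuous.
  - exact: chart_dom_open.
  - by rewrite /= !chart_invK.
have H1 : \forall p \near (chart_map c1 g, chart_map c2 h), chart_codom c1 p.1.
  by apply: (@cvg_fst _ _ (nbhs (chart_map c1 g)) (nbhs (chart_map c2 h)));
    exact: near_codom.
have H2 : \forall p \near (chart_map c1 g, chart_map c2 h), chart_codom c2 p.2.
  by apply: (@cvg_snd _ _ (nbhs (chart_map c1 g)) (nbhs (chart_map c2 h)));
    exact: near_codom.
by near=> p; split; [near: p..].
Unshelve. all: by end_near. Qed.

Lemma mul_chart_smooth c1 c2 d k : atlas c1 -> atlas c2 -> atlas d ->
  Ck_on (mul_chart_dom c1 c2 d) k (mul_chart c1 c2 d).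
Proof. by move=> a1 a2 ad; have [_ _ _ _ [[_ H] _]] := lieG; exact: H. Qed.

Lemma mul_chart_diff c1 c2 d g h : atlas c1 -> atlas c2 -> atlas d ->
  chart_dom c1 g -> chart_dom c2 h -> chart_dom d (g * h)%g ->
  differentiable (mul_chart c1 c2 d) (chart_map c1 g, chart_map c2 h).
Proof.
move=> a1 a2 ad dg dh dgh.
have [] // := C1_frame_diff frame_pair (nbhs_mul_chart_dom a1 a2 ad dg dh dgh)
  (mul_chart_smooth 1 a1 a2 ad).
Qed.

(** This is where second order smoothness enters: [Ad] is built from first derivatives of the
    multiplication, and the bracket differentiates [Ad]. *)
Lemma mul_chart_derive_diff c1 c2 d g h v : atlas c1 -> atlas c2 -> atlas d ->
  chart_dom c1 g -> chart_dom c2 h -> chart_dom d (g * h)%g ->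
  differentiable (fun p => 'D_v (mul_chart c1 c2 d) p) (chart_map c1 g,
    chart_map c2 h).
Proof.
move=> a1 a2 ad dg dh dgh.
have [_ /(_ v)[_ C]] := mul_chart_smooth 2 a1 a2 ad.
by have [] // := C1_frame_diff frame_pair (nbhs_mul_chart_dom a1 a2 ad dg dh dgh) C.
Qed.

Section SmoothMap.
Variable (f : G -> G).
Hypothesis fS : smooth_map atlas f.

Definition map_chart c d (u : 'rV[R]_n) := chart_map d (f (chart_inv c u)).
Definition map_chart_dom c d :=
  [set u | chart_codom c u /\ chart_dom d (f (chart_inv c u))].

Lemma nbhs_map_chart_dom c d g : atlas c -> atlas d -> chart_dom c g ->
  chart_dom d (f g) -> nbhs (chart_map c g) (map_chart_dom c d).
Proof.
move=> ac ad cg dg; near=> u; split; first by near: u; exact: near_codom.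
near: u; apply: (@near_continuous_at _ _ (f \o chart_inv c)).
- apply: continuous_comp; first exact: chart_inv_continuous.
  by have [fc _] := fS; exact: fc.
- exact: chart_dom_open.
- by rewrite /= chart_invK.
Unshelve. all: by end_near. Qed.

Lemma map_chart_smooth c d k : atlas c -> atlas d -> Ck_on (map_chart_dom c d) k
  (map_chart c d).
Proof. by move=> ac ad; have [_ H] := fS; exact: H. Qed.

Lemma map_chart_diff c d g : atlas c -> atlas d -> chart_dom c g ->
  chart_dom d (f g) -> differentiable (map_chart c d) (chart_map c g).
Proof.
move=> ac ad cg dg.
by have [] // := C1_frame_diff frame_rV (nbhs_map_chart_dom ac ad cg dg)
  (map_chart_smooth 1 ac ad).
Qed.
End SmoothMap.
End Charts.

(** * The adjoint representation *)

Section Adjoint.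
Context {R : realType} {n : nat} {G : topGroupType} {atlas : set (chart R n G)}.
Hypothesis lieG : lie_group atlas.
Context (e : chart R n G).
Hypotheses (ae : atlas e) (e1 : chart_dom e 1%g).
Implicit Types (g h : G) (X Y Z : 'rV[R]_n).

Local Notation x0 := (chart_map e 1%g).
Local Notation psi := (chart_inv e).
Local Notation phi := (chart_map e).

Lemma chart_inv1 : psi x0 = 1%g.
Proof. exact: (chart_invK lieG). Qed.

Definition local_rep (f : G -> G) (u : 'rV[R]_n) := phi (f (psi u)).

(** The class of maps on which [diff1] obeys the chain rule. Continuity is a separate clause because
    the values of a chart outside its domain are arbitrary: it keeps [f (psi u)] in the domain for
    [u] near [x0]. *)
Definition locally_diff (f : G -> G) : Prop :=
  [/\ f 1%g = 1%g, {for 1%g, continuous f} & differentiable (local_rep f) x0].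

Lemma near_chart_dom (f : G -> G) : f 1%g = 1%g -> {for 1%g, continuous f} ->
  \forall u \near x0, chart_dom e (f (psi u)).
Proof.
move=> f1 fc; apply: (@near_continuous_at _ _ (f \o psi)).
- apply: continuous_comp; first exact: (chart_inv_continuous lieG).
  by rewrite chart_inv1.
- exact: (chart_dom_open lieG).
- by rewrite /= chart_inv1 f1.
Qed.

Lemma local_rep1 (f : G -> G) : f 1%g = 1%g -> local_rep f x0 = x0.
Proof. by move=> f1; rewrite /local_rep chart_inv1 f1. Qed.

Lemma diff1_local_rep (f : G -> G) Y : locally_diff f ->
  diff1 e f Y = 'd (local_rep f) x0 Y.
Proof. by move=> [_ _ fd]; rewrite /diff1 deriveE. Qed.

Lemma near_local_rep_comp (f g : G -> G) : f 1%g = 1%g -> {for 1%g, continuous f} ->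
  \forall u \near x0, local_rep (g \o f) u = (local_rep g \o local_rep f) u.
Proof.
move=> f1 fc; near=> u; rewrite /local_rep /= (chart_invK lieG)//.
by near: u; exact: near_chart_dom.
Unshelve. all: by end_near. Qed.

Lemma near_differentiable {V W : normedModType R} (f g : V -> W) (x : V) :
  (\forall y \near x, f y = g y) -> differentiable g x -> differentiable f x.
Proof.
move=> fg dg; apply/diff_locallyP.
have E : f \o shift x = cst (f x) + 'd g x +o_ 0 id.
  apply/eqaddoP => eps eps0.
  have := diff_locally dg => /eqaddoP/(_ eps eps0).
  have fg0 : \forall h \near (0 : V), f (h + x) = g (h + x).
    by have := fg; rewrite (near_shift 0) /=; apply: filterS => h; rewrite subr0.
  apply: filterS2 fg0 => h fgh.
  by rewrite /= -![(_ + _ : _ -> _) _]/(_ + _) -![(- _ : _ -> _) _]/(- _) /=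
    /cst/= fgh (nbhs_singleton fg).
have c : continuous ('d g x) by exact: diff_continuous.
by rewrite (diff_unique c E).
Unshelve. all: by end_near. Qed.

Lemma locally_diff_comp (f g : G -> G) : locally_diff f -> locally_diff g ->
  locally_diff (g \o f) /\ forall Y, diff1 e (g \o f) Y = diff1 e g (diff1 e f Y).
Proof.
move=> Lf Lg; have [f1 fc fd] := Lf; have [g1 gc gd] := Lg.
have gd' : differentiable (local_rep g) (local_rep f x0) by rewrite local_rep1.
have dc : differentiable (local_rep g \o local_rep f) x0.
  exact: differentiable_comp fd gd'.
have nE := near_local_rep_comp g f1 fc.
have L : locally_diff (g \o f).
  split; first by rewrite /= f1.
    by apply: continuous_comp => //; rewrite f1.
  exact: near_differentiable nE dc.
split; first exact: L.
move=> Y; have [_ _ dgf] := L.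
apply: etrans (diff1_local_rep Y L) _; apply: etrans (esym (deriveE Y dgf)) _.
apply: etrans (near_eq_derive Y nE) _; apply: etrans (deriveE Y dc) _.
apply: etrans (congr1 (@^~ Y) (diff_comp fd gd')) _.
by rewrite (diff1_local_rep _ Lg) (diff1_local_rep _ Lf) /= local_rep1.
Qed.

Lemma locally_diff_smooth (f : G -> G) : smooth_map atlas f -> f 1%g = 1%g ->
  locally_diff f.
Proof.
move=> fS f1; split=> //; first by have [fc _] := fS; exact: fc.
by apply: (map_chart_diff lieG fS) => //; rewrite f1.
Qed.

Definition conjm g : G -> G := fun h => (g * h * g^-1)%g.

Lemma locally_diff_conj g : locally_diff (conjm g).
Proof.
have [_ _ charts _ _] := lieG.
have [c ac cg] := charts g; have [d ad dg] := charts (g^-1)%g.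
have gc : {for 1%g, continuous (conjm g)}.
  apply: (mulg_continuous_at lieG); last exact: cst_continuous.
  by apply: (mulg_continuous_at lieG); [exact: cst_continuous|exact: cvg_id].
have g1 : conjm g 1%g = 1%g by rewrite /conjm mulg1 mulgV.
split=> //.
(* Conjugation read as two multiplications in charts, through a chart [c] around [g] and a chart [d]
   around its inverse. *)
pose F (u : 'rV[R]_n) := mul_chart c d e (mul_chart c e c (chart_map c g, u),
  chart_map d (g^-1)%g).
apply: (@near_differentiable _ _ _ F).
  have : \forall u \near x0, chart_dom c (g * psi u)%g.
    apply: (@near_continuous_at _ _ (fun u => g * psi u)%g).
    - apply: (mulg_continuous_at lieG); first exact: cst_continuous.
      exact: (chart_inv_continuous lieG).
    - exact: (chart_dom_open lieG).
    - by rewrite chart_inv1 mulg1.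
  apply: filterS => u cu.
  by rewrite /F /mul_chart /= !(chart_invK lieG).
have d1 : differentiable (fun u : 'rV[R]_n => mul_chart c e c (chart_map c g,
  u)) x0.
  apply: (@differentiable_comp _ _ _ _ (fun u : 'rV[R]_n => (chart_map c g, u))).
    exact: differentiable_pair.
  by apply: (mul_chart_diff lieG) => //; rewrite mulg1.
apply: (@differentiable_comp _ _ _ _
  (fun u : 'rV[R]_n => (mul_chart c e c (chart_map c g, u), chart_map d
    (g^-1)%g)) (mul_chart c d e)).
  exact: differentiable_pair.
have -> : mul_chart c e c (chart_map c g, x0) = chart_map c g.
  by rewrite /mul_chart/= chart_inv1 (chart_invK lieG)// mulg1.
by apply: (mul_chart_diff lieG) => //; rewrite mulgV.
Qed.

Lemma AdE g Y : Ad e g Y = diff1 e (conjm g) Y.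
Proof. by []. Qed.

Lemma diff1_linear (f : G -> G) : locally_diff f -> linear (diff1 e f).
Proof. by move=> Lf k X Y; rewrite !diff1_local_rep// linearP. Qed.

Lemma diff1_id Y : diff1 e id Y = Y.
Proof.
rewrite /diff1.
have H : \forall u \near x0, phi (psi u) = u.
  apply: filterS (near_codom lieG ae e1) => u uc; exact: (chart_mapK lieG).
by rewrite (near_eq_derive _ H) derive_id.
Qed.

Lemma Ad1 Y : Ad e 1%g Y = Y.
Proof.
rewrite -[RHS]diff1_id AdE; congr (diff1 e _ Y).
by apply/funext => h; rewrite /conjm mul1g invg1 mulg1.
Qed.

Lemma AdM g h Y : Ad e (g * h)%g Y = Ad e g (Ad e h Y).
Proof.
rewrite !AdE.
have [_ <-] := locally_diff_comp (locally_diff_conj h) (locally_diff_conj g).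
congr (diff1 e _ Y); apply/funext => k.
by rewrite /conjm /= invgM !mulgA.
Qed.

Lemma Ad_linear g : linear (Ad e g).
Proof. exact/diff1_linear/locally_diff_conj. Qed.

(** Both sides are differentials at 1 of the same map, [s \o conjm g = conjm (s g) \o s]. *)
Lemma Ad_morph (s : G -> G) g Y : locally_diff s ->
  (forall g h, s (g * h)%g = (s g * s h)%g) ->
  diff1 e s (Ad e g Y) = Ad e (s g) (diff1 e s Y).
Proof.
move=> Ls sM; have s1 : s 1%g = 1%g by have [] := Ls.
have sV h : s (h^-1)%g = ((s h)^-1)%g.
  by apply: (mulgI (s h)); rewrite -sM !mulgV.
rewrite !AdE.
have [_ <-] := locally_diff_comp (locally_diff_conj g) Ls.
have [_ <-] := locally_diff_comp Ls (locally_diff_conj (s g)).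
by congr (diff1 e _ Y); apply/funext => k; rewrite /conjm /= !sM sV.
Qed.

End Adjoint.

(** * Differentiability of [Ad] at 1 and bilinearity of the bracket *)

Section AdjointDifferential.
Context {R : realType} {n : nat} {G : topGroupType} {atlas : set (chart R n G)}.
Hypothesis lieG : lie_group atlas.
Context (e : chart R n G).
Hypotheses (ae : atlas e) (e1 : chart_dom e 1%g).
Implicit Types (g h : G) (X Y Z : 'rV[R]_n).

Local Notation x0 := (chart_map e 1%g).
Local Notation psi := (chart_inv e).
Local Notation phi := (chart_map e).
Local Notation M := (mul_chart e e e).

Definition inv_chart := local_rep e (fun g => (g^-1)%g).

Lemma locally_diff_inv : locally_diff e (fun g => (g^-1)%g).
Proof.
apply: (locally_diff_smooth lieG ae e1); last by rewrite invg1.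
by have [_ _ _ _ []] := lieG.
Qed.

Lemma diff_left {V W : normedModType R} (f : 'rV[R]_n * V -> W) p (v : 'rV[R]_n) :
  'd f p (v, 0) = \sum_j v 0 j *: 'd f p (delta_mx 0 j, 0).
Proof.
have -> : (v, 0) = \sum_j v 0 j *: (delta_mx 0 j, 0) :> 'rV[R]_n * V.
  rewrite [LHS]surjective_pairing [RHS]surjective_pairing; congr pair.
    by rewrite (big_morph fst (id1 := 0) (op1 := +%R))//= -row_sum_delta.
  rewrite (big_morph snd (id1 := 0) (op1 := +%R))//= big1// => i _.
  by rewrite /= scaler0.
by rewrite linear_sum; apply: eq_bigr => j _; rewrite linearZ.
Qed.

(** Conjugation is left multiplication by [g] followed by right multiplication by its inverse, and
    the chain rule gives a derivative of [M] in a direction that itself depends on [u]. Expanding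
    that direction in the standard basis leaves derivatives of [M] in constant directions, with only
    coefficients and base points moving. *)
Lemma near_Ad_chart Y : \forall u \near x0, Ad e (psi u) Y =
  \sum_j 'D_(0, Y) M (u, x0) 0 j *: 'D_(delta_mx 0 j, 0) M (u, inv_chart u).
Proof.
near=> u.
have uc : chart_codom e u by near: u; exact: (near_codom lieG ae e1).
have dg := chart_dom_inv lieG ae uc.
have dgV : chart_dom e (psi u)^-1%g.
  near: u; apply: (near_chart_dom lieG ae e1 (f := fun g => (g^-1)%g)).
    by rewrite invg1.
  by have [_] := locally_diff_inv.
set g := psi u in dg dgV *.
have -> : u = phi g by rewrite (chart_mapK lieG).
rewrite /inv_chart /local_rep (chart_invK lieG)//.
have M1 : M (phi g, x0) = phi g.
  by rewrite /mul_chart/= !(chart_invK lieG)// mulg1.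
pose F (w : 'rV[R]_n) := M (M (phi g, w), phi (g^-1)%g).
have FE : \forall w \near x0, local_rep e (conjm g) w = F w.
  have : \forall w \near x0, chart_dom e (g * psi w)%g.
    apply: (@near_continuous_at _ _ (fun w => g * psi w)%g).
    - apply: (mulg_continuous_at lieG); first exact: cst_continuous.
      exact: (chart_inv_continuous lieG).
    - exact: (chart_dom_open lieG).
    - by rewrite (chart_inv1 lieG)// mulg1.
  by apply: filterS => w cw; rewrite /F /mul_chart /= !(chart_invK lieG).
have dM1 : differentiable M (phi g, x0) by apply: (mul_chart_diff lieG); rewrite
  ?mulg1.
have dM2 : differentiable M (phi g, phi (g^-1)%g).
  by apply: (mul_chart_diff lieG); rewrite ?mulgV.
have D1 : is_diff x0 (fun w : 'rV[R]_n => M (phi g, w)) (fun v => 'd M (phi g,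
  x0) (0, v)).
  have D0 : is_diff x0 (fun w : 'rV[R]_n => (phi g, w)) (fun v : 'rV[R]_n => (0,
    v)).
    exact: is_diff_pair.
  by have := is_diff_comp D0 (differentiableP dM1).
have D2 : is_diff x0 F (fun v => 'd M (phi g, phi (g^-1)%g) ('d M (phi g, x0)
  (0, v), 0)).
  have D0 : is_diff x0 (fun w => (M (phi g, w), phi (g^-1)%g))
     (fun v => ('d M (phi g, x0) (0, v), 0 : 'rV[R]_n)).
    exact: is_diff_pair.
  rewrite -M1 in dM2.
  by have := is_diff_comp D0 (differentiableP dM2); rewrite M1; apply.
rewrite AdE /diff1 (near_eq_derive _ FE) deriveE// diff_val.
apply: etrans (diff_left M (phi g, phi (g^-1)%g) _) _.
apply: eq_bigr => j _; congr (_ *: _); last exact: esym (deriveE _ dM2).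
exact: (congr1 (fun A : 'rV[R]_n => A 0 j) (esym (deriveE (0, Y) dM1))).
Unshelve. all: by end_near. Qed.

Lemma differentiable_Ad Y : differentiable (fun u => Ad e (psi u) Y) x0.
Proof.
apply: near_differentiable (near_Ad_chart Y) _.
have x0V : inv_chart x0 = x0 by rewrite /inv_chart (local_rep1 lieG)?invg1.
have D v : differentiable (fun p => 'D_v M p) (x0, x0).
  by apply: (mul_chart_derive_diff lieG) => //; rewrite mulg1.
apply: differentiable_rowP => k.
have -> : (fun u : 'rV[R]_n => (\sum_j 'D_(0, Y) M (u, x0) 0 j *:
     'D_(delta_mx 0 j, 0) M (u, inv_chart u)) 0 k) =
   \sum_j ((fun u => 'D_(0, Y) M (u, x0) 0 j) *
           (fun u => 'D_(delta_mx 0 j, 0) M (u, inv_chart u) 0 k)).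
  by apply/funext => u; rewrite summxE fct_sumE; apply: eq_bigr => j _; rewrite mxE.
apply: differentiable_sum => j; apply: differentiableM.
  apply: (@differentiable_comp _ _ _ _ (fun u => 'D_(0, Y) M (u, x0)) (fun A :
    'rV[R]_n => A 0 j)).
    apply: (@differentiable_comp _ _ _ _ (fun u : 'rV[R]_n => (u, x0)) (fun p =>
      'D_(0, Y) M p)) => //.
  exact: differentiable_coord.
apply: (@differentiable_comp _ _ _ _ (fun u => 'D_(delta_mx 0 j, 0) M (u,
  inv_chart u))
   (fun A : 'rV[R]_n => A 0 k)); last exact: differentiable_coord.
apply: (@differentiable_comp _ _ _ _ (fun u : 'rV[R]_n => (u, inv_chart u)) (fun
  p => 'D_(delta_mx 0 j, 0) M p)).
  by apply: differentiable_pair => //; have [] := locally_diff_inv.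
by rewrite x0V.
Qed.

Lemma bracketE X Y : bracket e X Y = 'd (fun u => Ad e (psi u) Y) x0 X.
Proof. by rewrite /bracket deriveE//; exact: differentiable_Ad. Qed.

Lemma bracket_linearl Y : linear (bracket e ^~ Y).
Proof. by move=> k X Z; rewrite !bracketE linearP. Qed.

Lemma bracket_linearr X : linear (bracket e X).
Proof.
move=> k Y Z; rewrite {1}/bracket.
have -> : (fun u => Ad e (psi u) (k *: Y + Z)) =
   k *: (fun u => Ad e (psi u) Y) + (fun u => Ad e (psi u) Z).
  by apply/funext => u; rewrite (Ad_linear lieG ae e1).
have dY W : derivable (fun u => Ad e (psi u) W) x0 X.
  exact/diff_derivable/differentiable_Ad.
by rewrite deriveD ?deriveZ//; exact: derivableZ.
Qed.

End AdjointDifferential.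

(** * The Lie bracket *)

Section Curves.
Context {R : realType}.

Lemma is_derive_chain {V W : normedModType R} (F : V -> W) (gamma : R -> V) (t : R)
    (v : V) : is_derive t 1 gamma v -> differentiable F (gamma t) ->
  is_derive t 1 (F \o gamma) ('d F (gamma t) v).
Proof.
move=> [/derivable1_diffP dg gv] dF.
have dc : differentiable (F \o gamma) t by exact: differentiable_comp.
split; first exact: diff_derivable.
by rewrite deriveE// diff_comp//= -gv deriveE.
Qed.

Lemma is_derive_coord {V : normedModType R} {n} (F : V -> 'rV[R]_n) t v dF i :
  is_derive t v F dF -> is_derive t v (fun s => F s 0 i) (dF 0 i).
Proof.
move=> [/[dup] dF0 /derivable_mxP dF1 <-]; split; first exact: dF1.
by rewrite derive_mx// mxE.
Qed.

Lemma is_derive_unique {V W : normedModType R} (f : V -> W) x v a b :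
  is_derive x v f a -> is_derive x v f b -> a = b.
Proof. by move=> [_ <-] [_ <-]. Qed.

Lemma is_derive_scalel {W : normedModType R} (f : R -> R) (w : W) (t df : R) :
  is_derive t 1 f df -> is_derive t 1 (fun s => f s *: w) (df *: w).
Proof.
move=> [/derivable1_diffP dg <-].
have dc := differentiableZl w dg.
split; first exact/diff_derivable.
by rewrite deriveE// diffZl// deriveE.
Qed.

(** Expanding [B] in the standard basis reduces the claim to the product rule for real coordinate
    functions. *)
Lemma is_derive_bilinear {n} (B : 'rV[R]_n -> 'rV[R]_n -> 'rV[R]_n)
    (gamma nu : R -> 'rV[R]_n) (t : R) dgamma dnu :
  (forall Y, linear (B ^~ Y)) -> (forall X, linear (B X)) ->
  is_derive t 1 gamma dgamma -> is_derive t 1 nu dnu ->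
  is_derive t 1 (fun s => B (gamma s) (nu s)) (B dgamma (nu t) + B (gamma t) dnu).
Proof.
move=> Bl Br dg dn.
have E X Y : B X Y = \sum_i \sum_j (X 0 i * Y 0 j) *: B (delta_mx 0 i) (delta_mx
  0 j).
  pose blM Y := GRing.isLinear.Build _ _ _ _ _ (Bl Y).
  pose bl Y : {linear _ -> _} := HB.pack (B ^~ Y) (blM Y).
  pose brM X := GRing.isLinear.Build _ _ _ _ _ (Br X).
  pose br X : {linear _ -> _} := HB.pack (B X) (brM X).
  rewrite {1}[X]row_sum_delta -[LHS]/(bl Y _) linear_sum; apply: eq_bigr => i _.
  rewrite linearZ/= {1}[Y]row_sum_delta -[B _ _]/(br _ _) linear_sum scaler_sumr.
  by apply: eq_bigr => j _; rewrite linearZ/= scalerA.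
have -> : (fun s => B (gamma s) (nu s)) = \sum_i \sum_j (fun s =>
   (gamma s 0 i * nu s 0 j) *: B (delta_mx 0 i) (delta_mx 0 j)).
  apply/funext => s; rewrite E fct_sumE; apply: eq_bigr => i _.
  by rewrite fct_sumE.
rewrite !E -big_split/=; apply: is_derive_sum => i.
rewrite -big_split/=; apply: is_derive_sum => j.
rewrite -scalerDl; apply: is_derive_scalel.
have := is_deriveM (is_derive_coord i dg) (is_derive_coord j dn).
by move=> /is_derive_eq; apply; rewrite addrC [dgamma 0 i * _]mulrC.
Qed.
End Curves.

Section LieBracket.
Context {R : realType} {n : nat} {G : topGroupType} {atlas : set (chart R n G)}.
Hypothesis lieG : lie_group atlas.
Context (e : chart R n G).
Hypotheses (ae : atlas e) (e1 : chart_dom e 1%g).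
Implicit Types (g h : G) (X Y Z : 'rV[R]_n).

Local Notation x0 := (chart_map e 1%g).
Local Notation psi := (chart_inv e).
Local Notation phi := (chart_map e).
Local Notation "[[ X , Y ]]" := (bracket e X Y).

(** Obtained by differentiating the identity of [Ad_morph] in the group variable at 1. It applies to
    the involution and to conjugations alike. *)
Lemma diff1_bracket (f : G -> G) X Y : locally_diff e f ->
  (forall g h, f (g * h)%g = (f g * f h)%g) ->
  diff1 e f [[X, Y]] = [[diff1 e f X, diff1 e f Y]].
Proof.
move=> Lf fM; have [f1 fc fd] := Lf.
have dA Z := differentiable_Ad lieG ae e1 Z.
have lf1 : local_rep e f x0 = x0 := local_rep1 lieG ae e1 f1.
pose A Z u := Ad e (psi u) Z.
have nE : \forall u \near x0, diff1 e f (A Y u) = (A (diff1 e f Y) \o local_rep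
  e f) u.
  near=> u; rewrite (Ad_morph lieG ae e1)//= /A /local_rep (chart_invK lieG)//.
  by near: u; exact: (near_chart_dom lieG).
have dL : differentiable ('d (local_rep e f) x0) (A Y x0).
  exact/linear_differentiable/diff_continuous.
rewrite [RHS](bracketE lieG)// (bracketE lieG)//.
rewrite [LHS](diff1_local_rep _ Lf) [X in _ = 'd _ _ X](diff1_local_rep _ Lf).
transitivity ('D_X (A (diff1 e f Y) \o local_rep e f) x0).
  rewrite -(near_eq_derive _ nE).
  have -> : (fun u => diff1 e f (A Y u)) = 'd (local_rep e f) x0 \o A Y.
    by apply/funext => u; rewrite (diff1_local_rep _ Lf).
  rewrite deriveE; last exact: (differentiable_comp (dA Y) dL).
  have Ed := diff_lin (A Y x0) (diff_continuous fd).
  exact: esym (etrans (congr1 (@^~ X) (diff_comp (dA Y) dL))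
    (congr1 (fun F => F ('d (A Y) x0 X)) Ed)).
have dA' : differentiable (A (diff1 e f Y)) (local_rep e f x0) by rewrite lf1;
  exact: dA.
apply: etrans (deriveE X (differentiable_comp fd dA')) _.
apply: etrans (congr1 (@^~ X) (diff_comp fd dA')) _.
exact: (congr1 (fun p => 'd (A (diff1 e f Y)) p ('d (local_rep e f) x0 X)) lf1).
Unshelve. all: by end_near. Qed.

Lemma conjmM g h k : conjm g (h * k)%g = (conjm g h * conjm g k)%g.
Proof. by rewrite /conjm !mulgA mulgVK. Qed.

Lemma Ad_bracket g X Y : Ad e g [[X, Y]] = [[Ad e g X, Ad e g Y]].
Proof.
apply: diff1_bracket; first exact: (locally_diff_conj lieG ae e1).
exact: conjmM.
Qed.

Lemma is_derive_Ad (gamma : R -> 'rV[R]_n) Z Y : gamma 0 = x0 ->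
  is_derive (0 : R) 1 gamma Z ->
  is_derive (0 : R) 1 (fun t => Ad e (psi (gamma t)) Y) [[Z, Y]].
Proof.
move=> g0 dg; rewrite (bracketE lieG)// -g0.
apply: (is_derive_chain (F := fun u => Ad e (psi u) Y)) => //.
by rewrite g0; exact: (differentiable_Ad lieG).
Qed.

(* Differentiate [Ad g [X, Y] = [Ad g X, Ad g Y]] along a curve [g] through 1 with
   velocity [Z]. *)
Lemma jacobi Z X Y : [[Z, [[X, Y]]]] = [[ [[Z, X]], Y]] + [[X, [[Z, Y]]]].
Proof.
have [gamma g0 dg] : exists2 gamma : R -> 'rV[R]_n, gamma 0 = x0 &
    is_derive (0 : R) 1 gamma Z.
  exists (fun t : R => t *: Z + x0); first by rewrite scale0r add0r.
  have := @is_derive_line R _ _ id x0 Z 0 _.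
  by rewrite derive_id; apply; exact: derivable_id.
have A0 W : Ad e (psi (gamma 0)) W = W.
  by rewrite g0 (chart_inv1 lieG)// (Ad1 lieG).
have D1 := is_derive_Ad [[X, Y]] g0 dg.
have D2 := is_derive_bilinear (bracket_linearl lieG ae e1)
  (bracket_linearr lieG ae e1) (is_derive_Ad X g0 dg) (is_derive_Ad Y g0 dg).
have E : (fun t => Ad e (psi (gamma t)) [[X, Y]]) =
    (fun t => [[Ad e (psi (gamma t)) X, Ad e (psi (gamma t)) Y]]).
  by apply/funext => t; exact: Ad_bracket.
rewrite E in D1; have U := is_derive_unique D1 D2.
apply: etrans U _; exact: (congr2 (fun V W : 'rV[R]_n => bracket e [[Z, X]] V +
  bracket e W [[Z, Y]]) (A0 Y) (A0 X)).
Qed.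
End LieBracket.

(** * Curves of fixed points of an involution *)

Lemma is_derive_estimate {R : realType} {V : normedModType R} (gamma : R -> V)
  (v : V) :
  (forall eps : R, 0 < eps -> exists2 d : R, 0 < d & forall t, `|t| < d ->
     `|gamma t - gamma 0 - t *: v| <= eps * `|t|) ->
  is_derive (0 : R) 1 gamma v.
Proof.
move=> H.
have C : (h^-1 *: ((gamma \o shift (0 : R)) (h *: (1 : R)) - gamma 0) @[h -->
  0^']) --> v.
  apply/cvgrPdist_le => eps eps0; have [d d0 Hd] := H _ eps0.
  near=> h.
  have h0 : h != 0 by near: h; exact: nbhs_dnbhs_neq.
  have hd : `|h| < d by near: h; exact: dnbhs0_lt.
  rewrite /= addr0 [_%:A]mulr1.
  rewrite -[v in X in X <= _](scalerK h0) -scalerBr normrZ normfV.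
  rewrite ler_pdivrMl ?normr_gt0// distrC mulrC; exact: Hd.
by split; [apply/cvg_ex; exists v|exact/cvg_lim].
Unshelve. all: by end_near. Qed.

Section Contraction.
Context {R : realType} {V : completeNormedModType R} (F : V -> V) (rho : R).
Hypotheses (rho0 : 0 < rho) (F0 : F 0 = 0).
Hypothesis FL : forall y z, `|y| <= rho -> `|z| <= rho ->
  `|F z - F y| <= 2^-1 * `|z - y|.

(** As [F 0 = 0], the Lipschitz bound sends the ball of radius [rho] into that of radius [rho / 2];
    hence [y |-> w + F y] preserves the former and has a fixed point there. *)
Lemma contraction_solve (w : V) : `|w| <= rho / 2 ->
  exists2 y, `|y| <= rho & y = w + F y.
Proof.
move=> wr.
pose U := [set y : V | `|y| <= rho].
have fU y : U y -> U (w + F y).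
  rewrite /U/= => yr; have := FL (y := 0) (z := y).
  rewrite normr0 F0 !subr0 => /(_ (ltW rho0) yr) Fy.
  by rewrite (le_trans (ler_normD _ _))//; lra.
pose f := mkfun_fun fU.
have fc : is_contraction f.
  exists (2^-1 : R)%:nng; split; first by rewrite /= invf_lt1 ?ltr1n.
  move=> [y z] [/= yr zr]; rewrite /f /= opprD addrACA subrr add0r.
  exact: FL.
have cU : closed U.
  by apply: (closed_comp _ (@closed_le _ rho)) => y _; exact: norm_continuous.
have [|y Uy yE] := banach_fixed_point fc cU; first by exists 0; rewrite /U/=
  normr0 ltW.
by exists y.
Qed.

(** This yields uniqueness of the solution when [w = w'], and Lipschitz dependence on [w] in
    general. *)
Lemma contraction_fixpoint_dist (w w' y y' : V) : `|y| <= rho -> `|y'| <= rho ->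
  y = w + F y -> y' = w' + F y' -> `|y - y'| <= 2 * `|w - w'|.
Proof.
move=> yr y'r yE y'E; have := FL y'r yr.
have : `|y - y'| <= `|w - w'| + `|F y - F y'|.
  by rewrite {1}yE {1}y'E opprD addrACA ler_normD.
lra.
Qed.

End Contraction.

(** Completeness of the coordinate space, required by the contraction principle. *)
HB.instance Definition _ (R : realType) (m n : nat) :=
  Uniform_isComplete.Build 'M[R]_(m, n) cauchy_cvg.

Section InvolutionCurve.
Context {R : realType} {n : nat} (s : 'rV[R]_n -> 'rV[R]_n) (x0 : 'rV[R]_n)
  (S : {linear 'rV[R]_n -> 'rV[R]_n}) (U : set 'rV[R]_n).
Hypotheses (sx0 : s x0 = x0) (SS : forall v, S (S v) = v).
Hypothesis sS : forall eps : R, 0 < eps -> exists2 rho : R, 0 < rho &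
  forall y z, `|y - x0| < rho -> `|z - x0| < rho ->
    `|s z - s y - S (z - y)| <= eps * `|z - y|.
Hypothesis ss : \forall u \near x0, s (s u) = u.
Hypothesis Ux0 : nbhs x0 U.

Let S_bound : exists2 K, 0 < K & forall v, `|S v| <= K * `|v|.
Proof. exact/linear_lipschitz/(frame_linear_continuous frame_rV). Qed.

(* [u - x0 = F (u - x0) + w] says that the linearization
   [((u - x0) + S (s u - x0)) / 2] of [s] takes the value [w] at [u]. *)
Let F (v : 'rV[R]_n) : 'rV[R]_n := 2^-1 *: (v - S (s (x0 + v) - x0)).

Let F0 : F 0 = 0.
Proof. by rewrite /F addr0 sx0 subrr linear0 subr0 scaler0. Qed.

(** Since [S] is its own inverse, an increment of [F] is half of [S] applied to the error of [S] as
    a linear approximation of [s]; that error is strictly small near [x0]. *)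
Let F_strict (eps : R) : 0 < eps -> exists2 rho : R, 0 < rho &
  forall y z, `|y| < rho -> `|z| < rho -> `|F z - F y| <= eps * `|z - y|.
Proof.
move=> eps0; have [K K0 SK] := S_bound.
have [rho rho0 H] := sS (divr_gt0 eps0 K0).
exists rho => // y z yr zr.
have := H (x0 + y) (x0 + z); rewrite ![x0 + _ - x0]addrAC !subrr !add0r => /(_
  yr zr).
have -> : x0 + z - (x0 + y) = z - y by rewrite opprD addrACA subrr add0r.
move=> Hs.
have -> : F z - F y = 2^-1 *: S (S (z - y) - (s (x0 + z) - s (x0 + y))).
  rewrite /F -scalerBr; congr (_ *: _).
  by rewrite !(linearB S) !SS; apply/rowP => j; rewrite !mxE; ring.
rewrite normrZ ger0_norm ?invr_ge0//.
have := SK (S (z - y) - (s (x0 + z) - s (x0 + y))).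
have : K * `|S (z - y) - (s (x0 + z) - s (x0 + y))| <= eps * `|z - y|.
  by rewrite mulrC -ler_pdivlMr// mulrAC distrC.
have := normr_ge0 (S (S (z - y) - (s (x0 + z) - s (x0 + y)))).
lra.
Qed.

(** The curve consists of the points where the linearization of [s] takes the value [t *: Z]. The
    map [s] sends such a point to one with linearization [S (t *: Z) = t *: Z], so uniqueness makes
    it a fixed point of [s]. *)
Lemma involution_curve (Z : 'rV[R]_n) : S Z = Z ->
  exists (gamma : R -> 'rV[R]_n) (d : R),
    [/\ 0 < d, gamma 0 = x0, is_derive (0 : R) 1 gamma Z &
      forall t, `|t| < d ->
        [/\ s (gamma t) = gamma t, U (gamma t) & {for t, continuous gamma}]].
Proof.
move=> SZ.
have [r0 r00 FL0] := F_strict (eps := 2^-1) ltac:(by rewrite invr_gt0).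
have [r1 r10 Hr1] : exists2 r, 0 < r & forall v, `|v| < r ->
    s (s (x0 + v)) = x0 + v /\ U (x0 + v).
  have : \forall u \near x0, s (s u) = u /\ U u by near=> u; split; near: u.
  move=> /nbhs_ballP[r /= r0' Hr]; exists r => // v vr.
  by apply: Hr; rewrite -ball_normE /= opprD addrA subrr sub0r normrN.
pose rho := Num.min r0 r1 / 2.
have rho0 : 0 < rho by rewrite divr_gt0// lt_min r00.
have rr0 : rho < r0 by rewrite /rho ltr_pdivrMr// gt_min ltr_pMr ?ltr1n.
have rr1 : rho < r1 by rewrite /rho ltr_pdivrMr// gt_min [r1 < _]ltr_pMr
  ?ltr1n// orbT.
have FL (y z : 'rV[R]_n) : `|y| <= rho -> `|z| <= rho -> `|F z - F y| <= 2^-1 *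
  `|z - y|.
  by move=> yr zr; apply: FL0; exact: le_lt_trans rr0.
have [r2 r20 Hr2] : exists2 r, 0 < r & forall v, `|v| < r -> `|s (x0 + v) - x0|
  <= rho.
  have [K K0 SK] := S_bound.
  have [r r_gt0 H] := sS ltr01.
  exists (Num.min r (rho / (1 + K))).
    by rewrite lt_min r_gt0 divr_gt0// addr_gt0.
  move=> v; rewrite lt_min ltr_pdivlMr ?addr_gt0// => /andP[vr vK].
  have := H x0 (x0 + v); rewrite sx0 subrr normr0 [x0 + v - x0]addrAC subrr add0r.
  move=> /(_ r_gt0 vr) H1; have := SK v.
  have : `|s (x0 + v) - x0| <= `|s (x0 + v) - x0 - S v| + `|S v|.
    by rewrite -{1}[s (x0 + v) - x0](subrK (S v)) ler_normD.
  lra.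
pose P (t : R) := [set y : 'rV[R]_n | `|y| <= rho /\ y = t *: Z + F y].
(* The default value 0 is taken only when the equation has no solution, which does not occur for
   [|t| < d]. *)
pose y (t : R) : 'rV[R]_n := xget 0 (P t).
(* For [|t| < d] one has [|t *: Z| <= rho / 2], so that a solution exists, and [|y t| < r2], so that
   [s] keeps the point in the ball where solutions are unique. *)
pose d := Num.min rho r2 / (2 * (1 + `|Z|)).
have Z1 : 0 < 1 + `|Z| by rewrite ltr_pwDl.
have d0 : 0 < d by rewrite divr_gt0 ?mulr_gt0// lt_min rho0.
have td (t : R) : `|t| < d -> `|t *: Z| <= rho / 2 /\ 2 * `|t *: Z| < r2.
  rewrite /d ltr_pdivlMr ?mulr_gt0// lt_min => /andP[t1 t2].
  have := normr_ge0 t; rewrite normrZ; nra.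
have yP (t : R) : `|t| < d -> `|y t| <= rho /\ y t = t *: Z + F (y t).
  move=> /td[t1 _]; have [v vr vE] := @contraction_solve R 'rV[R]_n F rho rho0
    F0 FL _ t1.
  exact: (xgetPex 0 (ex_intro (P t) v (conj vr vE))).
have yd (t t' : R) : `|t| < d -> `|t'| < d -> `|y t - y t'| <= 2 * (`|t - t'| *
  `|Z|).
  move=> /yP[y1 y2] /yP[y3 y4].
  by have := @contraction_fixpoint_dist R 'rV[R]_n F rho FL _ _ _ _ y1 y3 y2 y4;
    rewrite -scalerBl normrZ.
have d00 : `|0 : R| < d by rewrite normr0.
have y0 : y 0 = 0.
  have [y1 y2] := yP 0 d00.
  have z1 : `|0 : 'rV[R]_n| <= rho by rewrite normr0 ltW.
  have z2 : 0 = 0 + F 0 by rewrite F0 addr0.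
  have := @contraction_fixpoint_dist R 'rV[R]_n F rho FL _ _ _ _ y1 z1 y2 z2.
  rewrite scale0r !subr0 => /le_trans => /(_ 0).
  by rewrite [in X in X -> _]normr0 mulr0 lexx normr_le0 => /(_ isT)/eqP.
have yb (t : R) : `|t| < d -> `|y t| <= 2 * (`|t| * `|Z|).
  by move=> tt; have := yd t 0 tt d00; rewrite y0 !subr0.
exists (fun t : R => x0 + y t), d; split.
- exact: d0.
- by rewrite y0 addr0.
(* The deviation from [t *: Z] is exactly [F (y t)]; it is negligible against [y t], which is itself
   bounded by a multiple of [t]. *)
- apply: is_derive_estimate => eps eps0.
  have eps'0 : 0 < eps / (2 * (1 + `|Z|)) by rewrite divr_gt0 ?mulr_gt0.
  have [r r_gt0 H] := F_strict eps'0.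
  exists (Num.min d (r / (2 * (1 + `|Z|)))).
    by rewrite lt_min d0 divr_gt0// mulr_gt0.
  move=> t; rewrite lt_min => /andP[tt1]; rewrite ltr_pdivlMr ?mulr_gt0// => tt2.
  have [_ yE] := yP t tt1.
  have -> : x0 + y t - (x0 + y 0) - t *: Z = F (y t).
    by rewrite y0 addr0 [x0 + _]addrC addrK {1}yE [_ + F _]addrC addrK.
  have b := yb t tt1.
  have yr : `|y t| < r by apply: le_lt_trans b _; have := normr_ge0 t; nra.
  have := H 0 (y t); rewrite F0 !subr0 normr0 => /(_ r_gt0 yr) Fy.
  apply: (le_trans Fy); rewrite -mulrA ler_wpM2l ?(ltW eps0)//.
  by rewrite ler_pdivrMl ?mulr_gt0//; have := normr_ge0 t; nra.
move=> t tt; have [yr yE] := yP t tt; have [t1 t2] := td t tt.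
have ytr2 : `|y t| < r2 by apply: le_lt_trans t2; rewrite normrZ; exact: yb.
have [sst Ut] := Hr1 (y t) (le_lt_trans yr rr1).
split; [|exact: Ut|].
(* The displacement [y'] of the image under [s] solves the same equation as [y t]. *)
- pose y' := s (x0 + y t) - x0.
  have y'r : `|y'| <= rho by exact: Hr2.
  have sE : s (x0 + y t) = x0 + y' by rewrite /y' [RHS]addrC subrK.
  have y'E : y' = t *: Z + F y'.
    have H1 : y t - F (y t) = t *: Z by rewrite {1}yE addrK.
    have H2 : S (y t - F (y t)) = t *: Z by rewrite H1 linearZ/= SZ.
    rewrite -H2 /F -sE sst linearB linearZ/= linearB SS.
    rewrite -/y' [x0 + y t - x0]addrAC subrr add0r.
    by apply/rowP => j; rewrite !mxE; field.
  have := @contraction_fixpoint_dist R 'rV[R]_n F rho FL _ _ _ _ y'r yr y'E yE.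
  by rewrite subrr normr0 mulr0 normr_le0 subr_eq0 sE => /eqP ->.
- apply: cvgD; first exact: cvg_cst.
  apply/cvgrPdist_le => eps eps0; near=> t'.
  have t'd : `|t'| < d.
    near: t'; apply: (@near_continuous_at _ _ (fun t : R => `|t|) t [set r | r <
      d]) => //.
    exact: norm_continuous.
  apply: (le_trans (yd t t' tt t'd)).
  have : `|t - t'| <= eps / (2 * (1 + `|Z|)).
    near: t'; have := @cvg_id _ (nbhs t) => /cvgrPdist_le; apply.
    by rewrite divr_gt0// mulr_gt0.
  rewrite ler_pdivlMr ?mulr_gt0//; have := normr_ge0 (t - t'); nra.
Unshelve. all: by end_near. Qed.
End InvolutionCurve.

(** * Root vectors and eigenvectors *)

(** [m] is the exponent of the last nonzero iterate. It serves in both inclusions to move a vector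
    into the kernel of a nilpotent matrix. *)
Lemma nilpotent_last {F : fieldType} {n k : nat} (N : 'M[F]_n) (z : 'rV[F]_n) :
  N ^+ k = 0 -> z != 0 ->
  exists m : nat, z *m N ^+ m != 0 /\ z *m N ^+ m *m N = 0.
Proof.
move=> Nk z0.
have ex : exists m, z *m N ^+ m == 0 by exists k; rewrite Nk mulmx0.
case: (ex_minnP ex) => -[|m] /eqP zm mmin.
  by move: z0; rewrite -[z]mulmx1 zm eqxx.
exists m; split; last by rewrite -mulmxA mulmxE -exprSr.
by apply/negP => /mmin; rewrite ltnn.
Qed.

Lemma common_eigenvector_in {C : numClosedFieldType} {n} (K : 'M[C]_n)
    (As : seq 'M[C]_n) : K != 0 ->
  {in As, forall A, stablemx K A} -> {in As &, forall A B, comm_mx A B} ->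
  exists2 v : 'rV_n, v != 0 & (v <= K)%MS /\ {in As, forall A, stablemx v A}.
Proof.
move=> K0 KA AC.
have [|A' B' /mapP[A Ai ->] /mapP[B Bi ->]|v v0 /allP vA] :=
    @common_eigenvector C _ [seq restrictmx K A | A <- As].
- by rewrite lt0n mxrank_eq0.
- rewrite /comm_mx -!conjmxM ?inE ?stablemx_row_base ?KA//.
  by rewrite (AC A B).
exists (v *m row_base K); first by rewrite mulmx_free_eq0 ?row_base_free.
split; first by rewrite mulmx_sub// eq_row_base.
by move=> A Ai; rewrite -stablemx_restrict ?KA// vA//; apply/mapP; exists A.
Qed.

(** In diagonalizing coordinates, an entry killed by the square of a scalar is killed by the scalar.
    Equivalently, the image and the kernel of [A] meet only in 0. *)
Lemma diagonalizable_ker2 {F : fieldType} {n} (A : 'M[F]_n) (u : 'rV[F]_n) :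
  diagonalizable A -> u *m A *m A = 0 -> u *m A = 0.
Proof.
move=> [P Pu /(diagonalizable_forP _ Pu)/is_diag_mxP/diag_mxP[D PA]].
have -> : A = invmx P *m diag_mx D *m P by rewrite -PA !mulmxA mulVmx// mul1mx
  mulmxKV.
move=> H.
have : u *m invmx P *m diag_mx D *m diag_mx D = 0.
  have := congr1 (fun w => w *m invmx P) H; rewrite mul0mx => <-.
  by rewrite !mulmxA !(mulmxK Pu).
rewrite !mulmxA; set w := u *m invmx P => wD.
suff -> : w *m diag_mx D = 0 by rewrite mul0mx.
apply/rowP => j; move/rowP/(_ j): wD; rewrite !mul_mx_diag !mxE => /eqP.
by rewrite !mulf_eq0 -orbA orbb -mulf_eq0 => /eqP.
Qed.

Lemma anticomm_sqr {F : fieldType} {n} (A B : 'M[F]_n) :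
  A *m B = - (B *m A) -> A *m A *m B = B *m (A *m A).
Proof. by move=> AB; rewrite -mulmxA AB mulmxN !mulmxA AB mulNmx opprK. Qed.

(** * Kernel vectors of [l *: a + (bs + bn)], with [a], [bs], [bn], [th] in the roles of ad X, ad
    xi_s, ad xi_n and the involution *)

Section Spectrum.
Context {C : numClosedFieldType} {n : nat}.
Variables (a bs bn th : 'M[C]_n) (k : nat).
Hypotheses (abs : a *m bs = bs *m a) (abn : a *m bn = bn *m a)
  (bsn : bs *m bn = bn *m bs) (bnk : bn ^+ k = 0).
Hypothesis a_ss : forall u : 'rV[C]_n, u *m a *m a = 0 -> u *m a = 0.
Variable l : C.

Let L := l *: a + bs.

(** The last nonzero iterate of [z] under [bn] lies in the image of [a] and in the kernel of [L].
    The intersection of these two spaces is stable under the commuting family [As], hence contains a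
    common eigenvector. *)
Lemma root_vector_of_eigenvector (As : seq 'M[C]_n) (z : 'rV[C]_n) :
  {in As &, forall A B, comm_mx A B} ->
  {in As, forall A, comm_mx A a /\ comm_mx A bs} ->
  z != 0 -> (z <= a)%MS -> z *m (l *: a + (bs + bn)) = 0 ->
  exists2 y : 'rV[C]_n, y != 0 &
    [/\ (y <= a)%MS, y *m L = 0 & {in As, forall A, stablemx y A}].
Proof.
move=> AC Aab z0 za zE.
have [m [zm0 zmn]] := nilpotent_last bnk z0.
have LC A : comm_mx A a -> comm_mx A bs -> comm_mx A L.
  by rewrite /comm_mx mulmxDr mulmxDl -scalemxAr -scalemxAl => -> ->.
have bnL : comm_mx bn L by exact: LC.
have bnmC A : comm_mx bn A -> comm_mx (bn ^+ m) A.
  move=> c; elim: m {zm0 zmn} => [|m IH]; first by rewrite /comm_mx mul1mx mulmx1.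
  by rewrite exprS -mulmxE /comm_mx -mulmxA IH !mulmxA c.
pose K := (a :&: kermx L)%MS.
have zK : (z *m bn ^+ m <= K)%MS.
  rewrite sub_capmx; apply/andP; split.
    have [u ->] := submxP za.
    by rewrite -mulmxA -(bnmC a)// mulmxA submxMl.
  apply/sub_kermxP.
  have -> : L = l *: a + (bs + bn) - bn by rewrite addrA addrK.
  rewrite mulmxBr zmn subr0 -mulmxA bnmC ?mulmxA ?zE ?mul0mx//.
  by rewrite addrA; apply: comm_mxD.
have K0 : K != 0.
  by apply: contraNneq zm0 => KE; move: zK; rewrite KE submx0.
have [A /Aab[Aa Ab]|//|y y0 [yK yA]] := common_eigenvector_in (As := As) K0.
  rewrite sub_capmx; apply/andP; split.
    rewrite (submx_trans (submxMr _ (capmxSl _ _)))// -Aa; exact: submxMl.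
  rewrite (submx_trans (submxMr _ (capmxSr _ _)))//.
  by apply/sub_kermxP; rewrite -mulmxA LC// mulmxA mulmx_ker mul0mx.
exists y => //; move: yK; rewrite sub_capmx => /andP[ya /sub_kermxP yL]; by split.
Qed.

Hypotheses (ath : a *m th = - (th *m a)) (bnth : bn *m th = - (th *m bn)).

Lemma eigenvector_of_root_vector (Y : 'rV[C]_n) (al be : C) :
  Y *m th = - Y -> Y != 0 -> al != 0 -> Y *m a *m a = al ^+ 2 *: Y ->
  Y *m a *m bs = (al * be) *: Y -> l = - (be / al) ->
  exists2 z : 'rV[C]_n, z != 0 &
    (z <= (1%:M + th) *m a)%MS /\ z *m (l *: a + (bs + bn)) = 0.
Proof.
move=> Yth Y0 al0 Yaa Yabs lE.
have al20 : al ^+ 2 != 0 by rewrite expf_neq0.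
have aL : a *m L = L *m a by rewrite mulmxDr mulmxDl -scalemxAr -scalemxAl abs.
(* The hypotheses give [Y *m a *m L = 0] directly; as [a] commutes with [L] and [Y] is a multiple of
   [Y *m a *m a], this passes to [Y]. *)
have YL : Y *m L = 0.
  have E : Y *m a *m L = 0.
    rewrite mulmxDr -scalemxAr Yaa Yabs scalerA -scalerDl lE.
    by rewrite expr2 mulNr mulrA divfK// mulrC addNr scale0r.
  have : al ^+ 2 *: (Y *m L) = 0.
    by rewrite scalemxAl -Yaa -mulmxA aL mulmxA E mul0mx.
  by move/eqP; rewrite scaler_eq0 (negPf al20) => /eqP.
(* [N] is nilpotent and commutes with [a], [L] and [th], hence preserves the
   conditions on [Y]; on its kernel [bn] vanishes, as [a] has no nilpotent part. *)
pose N := bn *m a.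
have Lbn : L *m bn = bn *m L.
  by rewrite mulmxDr mulmxDl -scalemxAr -scalemxAl abn bsn.
have LN : L *m N = N *m L by rewrite /N mulmxA Lbn -!mulmxA aL.
have thN : th *m N = N *m th.
  have thbn : th *m bn = - (bn *m th) by rewrite bnth opprK.
  by rewrite /N mulmxA thbn mulNmx -!mulmxA ath mulmxN.
have aN : a *m N = N *m a by rewrite /N mulmxA abn.
have bnN : bn *m N = N *m bn by rewrite /N -mulmxA abn.
have Nj j : N ^+ j = bn ^+ j *m a ^+ j.
  by rewrite mulmxE exprMn_comm.
have [|m [zm0 zmN]] := @nilpotent_last _ _ k N Y _ Y0.
  by rewrite Nj bnk mul0mx.
have CN A : A *m N = N *m A -> A *m N ^+ m = N ^+ m *m A.
  move=> c; elim: m {zm0 zmN} => [|m IH]; first by rewrite mulmx1 mul1mx.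
  by rewrite exprS -mulmxE mulmxA c -mulmxA IH mulmxA.
set z := Y *m N ^+ m in zm0 zmN *.
have MN : (1%:M + th) *m a *m N = N *m ((1%:M + th) *m a).
  rewrite -mulmxA aN mulmxA [RHS]mulmxA; congr (_ *m a).
  by rewrite mulmxDl mulmxDr mul1mx mulmx1 thN.
have zM : (z <= (1%:M + th) *m a)%MS.
  rewrite /z.
  (* [Y *m a] is fixed by [th], because [a] anticommutes with [th] and [th] negates [Y]; so [1 + th]
     doubles it and the second [a] returns a multiple of [Y]. *)
  have -> : Y = ((2 * al ^+ 2)^-1 *: (Y *m a)) *m ((1%:M + th) *m a).
    have Yath : Y *m a *m th = Y *m a.
      by rewrite -mulmxA ath mulmxN mulmxA Yth mulNmx opprK.
    have YaM : Y *m a *m ((1%:M + th) *m a) = (2 * al ^+ 2) *: Y.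
      rewrite mulmxA mulmxDr mulmx1 Yath mulmxDl Yaa -scalerDl.
      by rewrite mulr_natl mulr2n.
    by rewrite -scalemxAl YaM scalerA mulVf ?scale1r// mulf_neq0// pnatr_eq0.
  by rewrite -mulmxA CN// mulmxA submxMl.
exists z => //; split=> //.
(* [z *m bn] lies in the image of [a] and is killed by [a]. *)
have zbn : z *m bn = 0.
  have [u zE] := submxP zM.
  have E : z *m bn = u *m (1%:M + th) *m bn *m a.
    by rewrite zE !mulmxA -(mulmxA _ a bn) abn !mulmxA.
  by rewrite E; apply: a_ss; rewrite -E -mulmxA.
by rewrite addrA mulmxDr zbn addr0 /z -mulmxA -CN// mulmxA YL mul0mx.
Qed.
End Spectrum.

(** * Lie algebras with an involution *)

Section LinearFun.
Context {F : fieldType} {m n : nat} (f : 'rV[F]_m -> 'rV[F]_n).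
Hypothesis fl : linear f.
Let fM := GRing.isLinear.Build _ _ _ _ _ fl.
Let fL : {linear 'rV[F]_m -> 'rV[F]_n} := HB.pack f fM.

Lemma linear_funD u v : f (u + v) = f u + f v.
Proof. exact: (linearD fL). Qed.

Lemma linear_funN u : f (- u) = - f u.
Proof. exact: (linearN fL). Qed.

Lemma linear_funZ k u : f (k *: u) = k *: f u.
Proof. exact: (linearZ_LR fL). Qed.

Lemma mul_rV_lin1_fun u : u *m lin1_mx f = f u.
Proof. exact: (mul_rV_lin1 fL). Qed.
End LinearFun.

Section SymmetricLieAlgebra.
Context {F : numFieldType} {n : nat} (br : 'rV[F]_n -> 'rV[F]_n -> 'rV[F]_n).
Implicit Types (X Y Z D v w : 'rV[F]_n).
Hypotheses (brl : forall Y, linear (br ^~ Y)) (brr : forall X, linear (br X)).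
Hypothesis jac : forall Z X Y, br Z (br X Y) = br (br Z X) Y + br X (br Z Y).

Definition adm X := lin1_mx (br X).
Definition kil X Y := \tr (adm X *m adm Y).

Lemma mul_adm Y X : Y *m adm X = br X Y.
Proof. exact: mul_rV_lin1_fun. Qed.

Lemma adm_linear : linear adm.
Proof.
by move=> k X Y; apply/row_matrixP => i; rewrite linearD linearZ/= !rowE
  !mul_adm brl.
Qed.

(** The Jacobi identity in matrix form; the factors appear in reverse order because matrices act on
    row vectors from the right. *)
Lemma adm_br Z X : adm (br Z X) = adm X *m adm Z - adm Z *m adm X.
Proof.
apply/row_matrixP => i; rewrite linearB/= !rowE mulmxA mul_adm !mulmxA !mul_adm.
by rewrite jac addrK.
Qed.

Lemma kilC X Y : kil X Y = kil Y X.
Proof. exact: mxtrace_mulC. Qed.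

Lemma kil_linearl k X Y Z : kil (k *: X + Y) Z = k * kil X Z + kil Y Z.
Proof. by rewrite /kil adm_linear mulmxDl mxtraceD -scalemxAl mxtraceZ. Qed.

Lemma kilDl X Y Z : kil (X + Y) Z = kil X Z + kil Y Z.
Proof. by rewrite -[X]scale1r kil_linearl scale1r mul1r. Qed.

Lemma kilZl k X Z : kil (k *: X) Z = k * kil X Z.
Proof.
have k0 : kil 0 Z = 0.
  by have := kilDl 0 0 Z; rewrite addr0 => /eqP; rewrite -subr_eq subrr => /eqP.
by rewrite -[k *: X]addr0 kil_linearl k0 addr0.
Qed.

Lemma kilNl X Z : kil (- X) Z = - kil X Z.
Proof. by rewrite -scaleN1r kilZl mulN1r. Qed.

Lemma kil_ad Z X Y : kil (br Z X) Y = - kil X (br Z Y).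
Proof.
rewrite /kil !adm_br mulmxBl mulmxBr ![\tr (_ - _)]raddfB /= opprB -!mulmxA.
by congr (_ - _); rewrite mxtrace_mulC mulmxA.
Qed.

(** The matrix of [f] conjugates [adm Z] to [adm (f Z)], and the trace is invariant under
    conjugation; the right inverse [g] makes that matrix invertible. *)
Lemma kil_aut (f : 'rV[F]_n -> 'rV[F]_n) (g : 'rV[F]_n -> 'rV[F]_n) X Y :
  linear f -> (forall Z, f (g Z) = Z) ->
  (forall X Y, f (br X Y) = br (f X) (f Y)) -> kil (f X) (f Y) = kil X Y.
Proof.
move=> fl fg fbr; set A := lin1_mx f.
have fA Z : Z *m A = f Z by exact: mul_rV_lin1_fun.
have Ainj : row_full A.
  apply/row_fullP; exists (\matrix_i g (row i 1%:M)).
  by apply/row_matrixP => i; rewrite row_mul rowK fA fg.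
have Au : A \in unitmx by rewrite -row_full_unit.
have E Z : A *m adm (f Z) = adm Z *m A.
  by apply/row_matrixP => i; rewrite !rowE !mulmxA fA !mul_adm fA fbr.
have adE Z : adm (f Z) = invmx A *m adm Z *m A.
  by rewrite -mulmxA -E mulKmx.
rewrite /kil !adE -!mulmxA mxtrace_mulC !mulmxA.
by rewrite -!mulmxA mulmxV// mulmx1 !mulmxA mulmxK.
Qed.

Hypothesis ss : forall X, (forall Y, kil X Y = 0) -> X = 0.

Lemma brC X Y : br X Y = - br Y X.
Proof.
apply/eqP; rewrite -addr_eq0; apply/eqP; apply: ss => Z.
rewrite /kil -[br X Y]scale1r adm_linear scale1r !adm_br.
by rewrite [X in X *m _](_ : _ = 0) ?mul0mx ?mxtrace0// addrC subrKA subrr.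
Qed.

Lemma brxx X : br X X = 0.
Proof.
have := brC X X; move/eqP; rewrite -addr_eq0 -mulr2n -scaler_nat scaler_eq0.
by rewrite pnatr_eq0 => /eqP.
Qed.

Variable th : 'rV[F]_n -> 'rV[F]_n.
Hypotheses (thl : linear th) (thK : forall Z, th (th Z) = Z).
Hypothesis thbr : forall X Y, th (br X Y) = br (th X) (th Y).

Let thN X : th (- X) = - th X. Proof. exact: linear_funN. Qed.
Let brNl X Y : br (- X) Y = - br X Y. Proof. exact: (linear_funN (brl Y)). Qed.
Let brNr X Y : br X (- Y) = - br X Y. Proof. exact: linear_funN. Qed.

Lemma kil_hq Z Y : th Z = Z -> th Y = - Y -> kil Z Y = 0.
Proof.
move=> tZ tY; have := kil_aut Z Y thl thK thbr; rewrite tZ tY kilC kilNl kilC.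
move=> /esym/eqP; rewrite -addr_eq0 -mulr2n -mulr_natl mulf_eq0 pnatr_eq0.
by move=> /eqP.
Qed.

Lemma hq_decomp Y : exists Z W, [/\ th Z = Z, th W = - W & Y = Z + W].
Proof.
exists (2^-1 *: (Y + th Y)), (2^-1 *: (Y - th Y)); split.
- by rewrite linear_funZ// linear_funD// thK addrC.
- by rewrite linear_funZ// linear_funD// thN thK -scalerN opprB addrC.
- by apply/rowP => j; rewrite !mxE; field.
Qed.

Lemma nondeg_h Z : th Z = Z -> (forall W, th W = W -> kil Z W = 0) -> Z = 0.
Proof.
move=> tZ H; apply: ss => Y; have [Z' [W [tZ' tW ->]]] := hq_decomp Y.
by rewrite kilC kilDl kilC H// kilC kil_hq// addr0.
Qed.

(** ** The tangent space [br h X] at a point [X] of [q] *)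

Variable X : 'rV[F]_n.
Hypothesis qX : th X = - X.

Definition tangent v := exists2 Z, th Z = Z & br Z X = v.

Hypothesis tangent_nondeg : forall v, tangent v ->
  (forall w, tangent w -> kil v w = 0) -> v = 0.

(** [1 + th] is twice the projection onto the fixed space of [th], so the row space is the image of
    that space under ad X. *)
Definition tangent_mx := (1%:M + lin1_mx th) *m adm X.

Lemma tangentP v : tangent v <-> (v <= tangent_mx)%MS.
Proof.
have E u : u *m tangent_mx = br X (u + th u).
  by rewrite mulmxA mulmxDr mulmx1 (mul_rV_lin1_fun thl) mul_adm.
split=> [[Z tZ <-]|/submxP[u ->]].
  (* The factor undoes the doubling of [Z] by [1 + th] and the sign in [br X Z = - br Z X]. *)
  have -> : br Z X = (- 2^-1 *: Z) *m tangent_mx.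
    rewrite E (linear_funZ thl) tZ -scalerDl.
    have -> : - 2^-1 + - 2^-1 = -1 :> F by field.
    by rewrite scaleN1r brNr brC.
  exact: submxMl.
rewrite E; exists (- (u + th u)).
  by rewrite thN linear_funD// thK addrC.
by rewrite brNl brC opprK.
Qed.

Lemma tangent_q v : tangent v -> th v = - v.
Proof. by move=> [Z tZ <-]; rewrite thbr tZ qX brNr. Qed.

(** By invariance of the Killing form, [w] is orthogonal to every [br Z X]. Thus bracketing with [X]
    is injective on the tangent space, which is what pins down the shape operator. *)
Lemma tangent_eq0 w : tangent w -> br w X = 0 -> w = 0.
Proof.
move=> Tw wX; apply: tangent_nondeg => // _ [Z tZ <-].
by rewrite kilC brC kilNl kil_ad opprK brC wX oppr0 kilC -[0](scale0r X) kilZl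
  mul0r.
Qed.

(** [br D X] is fixed by [th], and invariance of the Killing form makes it orthogonal to the whole
    fixed space, on which the form is nondegenerate. *)
Lemma normal_br D : th D = - D -> (forall v, tangent v -> kil D v = 0) -> br D X
  = 0.
Proof.
move=> qD H; apply: nondeg_h; first by rewrite thbr qD qX brNl brNr opprK.
move=> Z tZ; have : kil (br Z X) D = 0 by rewrite kilC H//; exists Z.
by rewrite !kil_ad brC => /eqP; rewrite oppr_eq0 kilC kilNl oppr_eq0 kilC =>
  /eqP->; rewrite oppr0.
Qed.

Let gram : 'M[F]_n := \matrix_(i, j) kil (delta_mx 0 i) (delta_mx 0 j).

Let gramE u v : kil u v = (u *m gram *m v^T) 0 0.
Proof.
have kl w : linear (fun u => (kil u w)%:M : 'rV[F]_1).
  by move=> k x y; rewrite kil_linearl raddfD/= -scale_scalar_mx.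
have k2 x y : kil x y = ((kil x y)%:M : 'rV[F]_1) 0 0 by rewrite mxE mulr1n.
have E w : u *m lin1_mx (fun u => (kil u w)%:M : 'rV[F]_1) = (kil u w)%:M.
  exact: mul_rV_lin1_fun.
rewrite k2 -E !mxE; apply: esym.
under eq_bigr => j _ do rewrite !mxE mulr_suml.
rewrite exchange_big/=; apply: eq_bigr => i _.
rewrite !mxE mulr1n kilC.
have E' : v *m lin1_mx (fun u => (kil u (delta_mx 0 i))%:M : 'rV[F]_1) = (kil v
  (delta_mx 0 i))%:M.
  exact: mul_rV_lin1_fun.
rewrite [kil v _]k2 -E' !mxE mulr_sumr; apply: eq_bigr => j _.
by rewrite !mxE mulr1n -mulrA; congr (_ * _); rewrite mulrC kilC.
Qed.

Lemma tangent_projection D : exists2 w, tangent w &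
  forall v, tangent v -> kil (D + w) v = 0.
Proof.
pose M := tangent_mx; pose N := M *m gram *m M^T.
(* Solvability of the normal equations: a column [c] with [N *m c = 0] gives a tangent vector
   [c^T *m M] orthogonal to all tangent vectors, hence zero, so that [M^T *m c = 0]. *)
have sub : (D *m gram *m M^T <= N)%MS.
  rewrite submxE; apply/eqP.
  suff H : M^T *m cokermx N = 0 by rewrite -(mulmxA _ M^T) H mulmx0.
  apply: trmx_inj; rewrite trmx0 trmx_mul trmxK.
  apply/row_matrixP => i; rewrite row0 row_mul.
  have T : tangent (row i (cokermx N)^T *m M) by apply/tangentP; exact: submxMl.
  apply: tangent_nondeg => // w /tangentP/submxP[u ->].
  rewrite kilC gramE trmx_mul -/M.
  have -> : u *m M *m gram *m (M^T *m (row i (cokermx N)^T)^T) =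
     u *m (N *m col i (cokermx N)) by rewrite tr_row trmxK !mulmxA.
  by rewrite colE (mulmxA N) mulmx_coker mul0mx mulmx0 mxE.
have /submxP[u uE] := sub.
exists (- (u *m M)) => [|v /tangentP/submxP[u' ->]].
  by apply/tangentP; rewrite -mulNmx submxMl.
rewrite gramE trmx_mul mulmxBl mulmxA mulmxBl uE /N !mulmxA subrr mul0mx mxE//.
Qed.

End SymmetricLieAlgebra.

(** * Complexification *)

Section Complexification.
Context {R : realType} {n : nat}.
Local Notation rc := (map_mx (real_complex R)).
Local Notation ii := (0 +i* 1 : R[i]).

Lemma cplxE (x y : 'rV[R]_n) : cplx x y = rc x + ii *: rc y.
Proof.
apply/rowP => j; rewrite !mxE; apply/eqP; rewrite eq_complex /=.
by rewrite !mul0r !mul1r subrr addr0 !add0r !eqxx.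
Qed.

Lemma re_cplx (x y : 'rV[R]_n) : re_part (cplx x y) = x.
Proof. by apply/rowP => j; rewrite !mxE. Qed.

Lemma im_cplx (x y : 'rV[R]_n) : im_part (cplx x y) = y.
Proof. by apply/rowP => j; rewrite !mxE. Qed.

Lemma cplxK (z : 'rV[R[i]]_n) : cplx (re_part z) (im_part z) = z.
Proof. by apply/rowP => j; rewrite !mxE; case: (z 0 j). Qed.

Lemma cplx0E (x : 'rV[R]_n) : cplx x 0 = rc x.
Proof. by rewrite cplxE map_mx0 scaler0 addr0. Qed.

Lemma cplx_mulmx m (x y : 'rV[R]_n) (A : 'M[R]_(n, m)) :
  cplx x y *m rc A = cplx (x *m A) (y *m A).
Proof.
rewrite cplxE mulmxDl -scalemxAl -!map_mxM.
apply/rowP => j; rewrite !mxE; apply/eqP; rewrite eq_complex /=.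
by rewrite !mul0r !mul1r subrr addr0 !add0r !eqxx.
Qed.
End Complexification.

Lemma re_mulmx {R : realType} {n m} (z : 'rV[R[i]]_n) (A : 'M[R]_(n, m)) :
  re_part (z *m map_mx (real_complex R) A) = re_part z *m A.
Proof. by rewrite -{1}(cplxK z) cplx_mulmx re_cplx. Qed.

Lemma im_mulmx {R : realType} {n m} (z : 'rV[R[i]]_n) (A : 'M[R]_(n, m)) :
  im_part (z *m map_mx (real_complex R) A) = im_part z *m A.
Proof. by rewrite -{1}(cplxK z) cplx_mulmx im_cplx. Qed.

Lemma submx_cplx {R : realType} {n} (z : 'rV[R[i]]_n) (A : 'M[R]_n) :
  (z <= map_mx (real_complex R) A)%MS <->
  (re_part z <= A)%MS /\ (im_part z <= A)%MS.
Proof.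
split=> [/submxP[u ->]|[/submxP[u uE] /submxP[v vE]]].
  by rewrite re_mulmx im_mulmx !submxMl.
by rewrite -(cplxK z) uE vE -cplx_mulmx submxMl.
Qed.

Section ComplexAdjoint.
Context {R : realType} {n : nat} (br : 'rV[R]_n -> 'rV[R]_n -> 'rV[R]_n).
Hypotheses (brl : forall Y, linear (br ^~ Y)) (brr : forall X, linear (br X)).
Local Notation rc := (map_mx (real_complex R)).
Local Notation ii := (0 +i* 1 : R[i]).
Local Notation ad := (adm br).

(** The complex-linear extension of [ad], expanded over the real basis so that linearity in [A] is
    immediate. *)
Definition adC (A : 'rV[R[i]]_n) : 'M[R[i]]_n := \sum_i A 0 i *: rc (ad
  (delta_mx 0 i)).

Lemma adC_linear k A B : adC (k *: A + B) = k *: adC A + adC B.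
Proof.
rewrite /adC scaler_sumr -big_split/=; apply: eq_bigr => i _.
by rewrite !mxE scalerDl scalerA.
Qed.

Lemma adC_real (x : 'rV[R]_n) : adC (rc x) = rc (ad x).
Proof.
have adl : linear ad := adm_linear brl brr.
pose fM := GRing.isLinear.Build _ _ _ _ _ adl.
pose fL : {linear 'rV[R]_n -> 'M[R]_n} := HB.pack ad fM.
rewrite {2}[x]row_sum_delta -[ad _]/(fL _) linear_sum raddf_sum.
by apply: eq_bigr => i _; rewrite linearZ/= map_mxZ mxE.
Qed.

Lemma adC_cplx (x y : 'rV[R]_n) : adC (cplx x y) = rc (ad x) + ii *: rc (ad y).
Proof. by rewrite cplxE addrC adC_linear !adC_real addrC. Qed.

Definition complex_bracket (x y : 'rV[R[i]]_n) : 'rV[R[i]]_n :=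
  cplx (br (re_part x) (re_part y) - br (im_part x) (im_part y))
       (br (re_part x) (im_part y) + br (im_part x) (re_part y)).

Lemma complex_bracketE (A Y : 'rV[R[i]]_n) : complex_bracket A Y = Y *m adC A.
Proof.
suff H a1 a2 y1 y2 : cplx (br a1 y1 - br a2 y2)
    (br a1 y2 + br a2 y1) = cplx y1 y2 *m adC (cplx a1 a2).
  by rewrite /complex_bracket H !cplxK.
rewrite adC_cplx.
have E y a : br a y = y *m ad a := esym (mul_adm brr y a).
rewrite (E y1 a1) (E y2 a2) (E y2 a1) (E y1 a2).
move: (ad a1) (ad a2) => A1 A2.
rewrite mulmxDr -scalemxAr !cplx_mulmx.
apply/rowP => j; rewrite !mxE; apply/eqP; rewrite eq_complex /=.
by rewrite !mul0r !mul1r sub0r add0r !eqxx.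
Qed.
End ComplexAdjoint.

(** * Eigenvalues of the complexified shape operator and restricted roots *)

Section ShapeSpectrum.
Context {R : realType} {n : nat} (br : 'rV[R]_n -> 'rV[R]_n -> 'rV[R]_n)
  (th : 'rV[R]_n -> 'rV[R]_n).
Local Notation rc := (map_mx (real_complex R)).
Local Notation ad := (adm br).
Hypotheses (brl : forall Y, linear (br ^~ Y)) (brr : forall X, linear (br X)).
Hypothesis jac : forall Z X Y, br Z (br X Y) = br (br Z X) Y + br X (br Z Y).
Hypothesis ss : forall X, (forall Y, kil br X Y = 0) -> X = 0.
Hypotheses (thl : linear th) (thK : forall Z, th (th Z) = Z).
Hypothesis thbr : forall X Y, th (br X Y) = br (th X) (th Y).

Variable X : 'rV[R]_n.
Hypothesis qX : th X = - X.
Local Notation T := (tangent br th X).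
Hypothesis tangent_nondeg : forall v, T v ->
  (forall w, T w -> kil br v w = 0) -> v = 0.

Let mul_ad Y Z : Y *m ad Z = br Z Y.
Proof. exact: mul_adm brr Y Z. Qed.

Let adlin k Y Z : ad (k *: Y + Z) = k *: ad Y + ad Z.
Proof. exact: adm_linear brl brr k Y Z. Qed.

Let ad_br Z Y : ad (br Z Y) = ad Y *m ad Z - ad Z *m ad Y.
Proof. exact: adm_br brr jac Z Y. Qed.

Let brA Y Z : br Y Z = - br Z Y.
Proof. exact: brC brl brr jac ss Y Z. Qed.

Let ad0 : ad 0 = 0.
Proof. by have := adlin (-1) 0 0; rewrite scaleN1r oppr0 addr0 scaleN1r addNr. Qed.

Let ad_comm Y Z : br Y Z = 0 -> ad Y *m ad Z = ad Z *m ad Y.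
Proof.
by move=> YZ; have := ad_br Y Z; rewrite YZ ad0 => /esym/eqP; rewrite subr_eq0
  => /eqP.
Qed.

Let TH := lin1_mx th.

Let mul_TH Y : Y *m TH = th Y.
Proof. exact: mul_rV_lin1_fun. Qed.

Let ad_TH Y : th Y = - Y -> ad Y *m TH = - (TH *m ad Y).
Proof.
move=> qY; apply/row_matrixP => i; rewrite linearN/= !rowE !mulmxA !mul_ad !mul_TH.
by rewrite thbr qY (linear_funN (brl _)).
Qed.

Let M := (1%:M + TH) *m ad X.

Let tangentM v : T v <-> (v <= M)%MS.
Proof. exact: (tangentP brl brr jac ss thl thK). Qed.

Let tangentC z : cplx_set (T) z <-> (z <= rc M)%MS.
Proof.
rewrite submx_cplx; split=> -[z1 z2]; split.
- exact/tangentM.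
- exact/tangentM.
- exact/tangentM.
- exact/tangentM.
Qed.

Let M_sub_ad : (rc M <= rc (ad X))%MS.
Proof. by rewrite map_mxM submxMl. Qed.

Let tangent_ker v : T v -> br v X = 0 -> v = 0.
Proof. exact: (tangent_eq0 brl brr jac ss tangent_nondeg). Qed.

Variables (xi : 'rV[R]_n) (S : 'rV[R]_n -> 'rV[R]_n).
Hypothesis shapeS : forall v, T v -> T (S v) /\ br (S v) X = br xi v.

Lemma shape_eigenvectorE (l : R[i]) z : cplx_set (T) z ->
  cplx_op S z = l *: z <-> z *m (l *: rc (ad X) + rc (ad xi)) = 0.
Proof.
move=> Tz; have [z1 z2] := Tz.
have SE v : T v -> S v *m ad X = - v *m ad xi.
  by move=> /shapeS[_ vE]; rewrite (mul_ad _ X) (brA X) vE mulNmx mul_ad.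
have wE : cplx_op S z *m rc (ad X) = - (z *m rc (ad xi)).
  rewrite /cplx_op cplx_mulmx !SE// -cplx_mulmx -mulNmx; congr (_ *m _).
  by rewrite -[in RHS](cplxK z); apply/rowP => j; rewrite !mxE; apply/eqP;
    rewrite eq_complex /= !eqxx.
split=> [E|E].
  by rewrite mulmxDr -scalemxAr scalemxAl -E wE addNr.
(* The defect [d] is tangent and killed by ad X, so its real and imaginary parts vanish by
   injectivity of ad X on tangent vectors. *)
pose d := cplx_op S z - l *: z.
have dT : cplx_set (T) d.
  apply/tangentC; rewrite addmx_sub//; last first.
    by rewrite eqmx_opp; apply: scalemx_sub; exact/tangentC.
  apply/tangentC; rewrite /cplx_op; split; rewrite ?re_cplx ?im_cplx.
    exact: (shapeS z1).1.
  exact: (shapeS z2).1.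
have dX : d *m rc (ad X) = 0.
  rewrite mulmxBl wE -scalemxAl; apply/eqP; rewrite -opprD oppr_eq0 addrC.
  by move: E; rewrite mulmxDr -scalemxAr => ->.
have [d1 d2] := dT.
have d0 : d = 0.
  rewrite -(cplxK d) (tangent_ker d1); last first.
    by rewrite brA -mul_ad -re_mulmx dX; apply/rowP => j; rewrite !mxE oppr0.
  rewrite (tangent_ker d2); last first.
    by rewrite brA -mul_ad -im_mulmx dX; apply/rowP => j; rewrite !mxE oppr0.
  by apply/rowP => j; rewrite !mxE.
by apply/eqP; rewrite -subr_eq0 -/d d0.
Qed.

Variables (xi_s xi_n : 'rV[R]_n) (k : nat) (a : {vspace 'rV[R]_n}).
Hypotheses (xiE : xi = xi_s + xi_n) (qxi : th xi = - xi) (xiX : br xi X = 0).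
Hypotheses (X_ss : diagonalizable (rc (ad X))) (xi_nk : ad xi_n ^+ k = 0)
  (xi_sn : br xi_s xi_n = 0).
Hypotheses (a_q : forall A, A \in a -> th A = - A)
  (a_ab : forall A B, A \in a -> B \in a -> br A B = 0) (Xa : X \in a) (sa :
    xi_s \in a).

Local Notation aC := (cplx_vspace a).
Local Notation qC := (cplx_set [set Z | th Z = - Z]).

(* [root_space] and [restricted_root] for an abstract bracket and involution. *)
Definition complex_root_space (alpha : 'rV[R[i]]_n -> R[i]) :
    set 'rV[R[i]]_n :=
  [set Y | qC Y /\ forall A, aC A ->
    complex_bracket br A (complex_bracket br A Y) = alpha A ^+ 2 *: Y].

Definition complex_root (alpha : 'rV[R[i]]_n -> R[i]) : Prop :=
  [/\ forall (k : R[i]) A B, aC A -> aC B -> alpha (k *: A + B) = k * alpha A +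
    alpha B,
      exists2 A, aC A & alpha A <> 0 &
      exists2 Y, complex_root_space alpha Y & Y <> 0].

Let aC_real A : A \in a -> aC (cplx A 0).
Proof. by move=> Aa; split; rewrite ?re_cplx ?im_cplx//=; exact: mem0v. Qed.

Let rad_comm Y Z : br Y Z = 0 -> rc (ad Y) *m rc (ad Z) = rc (ad Z) *m rc (ad Y).
Proof. by move=> YZ; rewrite -!map_mxM ad_comm. Qed.

Let adE : rc (ad xi) = rc (ad xi_s) + rc (ad xi_n).
Proof. by rewrite xiE -[xi_s]scale1r adlin !scale1r map_mxD. Qed.

Let abs : rc (ad X) *m rc (ad xi_s) = rc (ad xi_s) *m rc (ad X).
Proof. by rewrite rad_comm// a_ab. Qed.

Let bsn : rc (ad xi_s) *m rc (ad xi_n) = rc (ad xi_n) *m rc (ad xi_s).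
Proof. exact: rad_comm. Qed.

(** ad X commutes with ad xi because [xi] is normal, and with ad xi_s because both vectors lie in
    [a]; subtract. *)
Let abn : rc (ad X) *m rc (ad xi_n) = rc (ad xi_n) *m rc (ad X).
Proof.
have /(congr1 (fun A => A - rc (ad xi_s) *m rc (ad X))) := rad_comm xiX.
by rewrite adE mulmxDl mulmxDr abs ![rc (ad xi_s) *m _ + _]addrC !addrK => ->.
Qed.

Let bnk : rc (ad xi_n) ^+ k = 0.
Proof.
suff -> : rc (ad xi_n) ^+ k = rc (ad xi_n ^+ k) by rewrite xi_nk map_mx0.
elim: k => [|m IH]; first by rewrite !expr0 map_mx1.
by rewrite !exprS IH -!mulmxE map_mxM.
Qed.

Let a_ss (u : 'rV[R[i]]_n) : u *m rc (ad X) *m rc (ad X) = 0 -> u *m rc (ad X) = 0.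
Proof. exact: diagonalizable_ker2. Qed.

Let radTH Y : th Y = - Y -> rc (ad Y) *m rc TH = - (rc TH *m rc (ad Y)).
Proof. by move=> qY; rewrite -!map_mxM ad_TH// map_mxN. Qed.

(** A common eigenvector is available for a finite list of matrices; this extends stability from a
    basis of [a] to all of [a]. *)
Let ad_vbasis (A : 'rV[R]_n) (y : 'rV[R[i]]_n) : A \in a ->
  (forall i : 'I_(\dim a), (y *m rc (ad (vbasis a)`_i) <= y)%MS) ->
  (y *m rc (ad A) <= y)%MS.
Proof.
move=> Aa H; rewrite {1}(coord_vbasis Aa).
have adD Y Z : ad (Y + Z) = ad Y + ad Z by rewrite -[Y]scale1r adlin !scale1r.
have adZ c Y : ad (c *: Y) = c *: ad Y by rewrite -[c *: Y]addr0 adlin ad0 addr0.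
rewrite (big_morph ad adD ad0) raddf_sum mulmx_sumr; apply: summx_sub => i _.
by rewrite /= adZ map_mxZ -scalemxAr scalemx_sub.
Qed.

Lemma root_of_shape_eigenvalue (l : R[i]) z : cplx_set T z -> z <> 0 ->
  cplx_op S z = l *: z -> exists alpha, [/\ complex_root alpha,
    alpha (cplx X 0) <> 0 & - (alpha (cplx xi_s 0) / alpha (cplx X 0)) = l].
Proof.
move=> Tz /eqP z0 /(shape_eigenvectorE _ Tz).
rewrite adE => zE.
have za : (z <= rc (ad X))%MS by apply: submx_trans M_sub_ad; exact/tangentC.
pose As := [seq rc (ad A) | A <- vbasis a].
have AsP B : B \in As -> exists2 A, A \in a & B = rc (ad A).
  by move=> /mapP[A Ab ->]; exists A => //; exact: vbasis_mem.
have [||y y0 [ya yL yA]] := root_vector_of_eigenvector abn bsn bnk (As := As) _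
  _ z0 za zE.
- by move=> _ _ /AsP[A Aa ->] /AsP[B Ba ->]; apply: rad_comm; exact: a_ab.
- by move=> _ /AsP[A Aa ->]; split; apply: rad_comm; exact: a_ab.
have yAC A : A \in a -> (y *m rc (ad A) <= y)%MS.
  move=> Aa; apply: ad_vbasis => // i; apply: yA; apply/mapP.
  by exists (vbasis a)`_i => //; rewrite mem_nth ?size_tuple.
have [j yj] := rV0Pn _ y0.
(* Reading the eigenvalue off a nonzero coordinate of [y] makes [alpha] linear by construction. *)
pose alpha (A : 'rV[R[i]]_n) := (y *m adC br A) 0 j / y 0 j.
have alphaP A : aC A -> y *m adC br A = alpha A *: y.
  move=> [A1 A2]; have : (y *m adC br A <= y)%MS.
    rewrite -(cplxK A) (adC_cplx brl brr) mulmxDr -scalemxAr addmx_sub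
      ?scalemx_sub//.
      exact: yAC.
    exact: yAC.
  by move=> /sub_rVP[c cE]; rewrite {1}cE /alpha cE mxE mulfK.
have alphaR A : A \in a -> y *m rc (ad A) = alpha (cplx A 0) *: y.
  by move=> Aa; rewrite -alphaP ?cplx0E ?(adC_real brl brr)// -cplx0E; exact:
    aC_real.
(* Otherwise [y] would lie both in the image and in the kernel of the diagonalizable ad X. *)
have aX0 : alpha (cplx X 0) != 0.
  apply/negP => /eqP aX; have := alphaR _ Xa; rewrite aX scale0r.
  have [u uE] := submxP ya; rewrite uE => /a_ss; rewrite -uE => y00.
  by rewrite y00 eqxx in y0.
exists alpha; split; [split| |].
- move=> c A B _ _; rewrite /alpha adC_linear mulmxDr -scalemxAr !mxE.
  by rewrite mulrDl mulrA.
- by exists (cplx X 0); [exact: aC_real|exact/eqP].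
(* Twice the component of [y] in the complexified q. Squares of ad A commute with the involution, so
   it keeps the eigenvalue [alpha A ^+ 2]. *)
- exists (y - y *m rc TH).
    split.
      have -> : y - y *m rc TH = y *m rc (1%:M - TH) by rewrite map_mxB map_mx1
        mulmxBr mulmx1.
      have q (v : 'rV[R]_n) : th (v *m (1%:M - TH)) = - (v *m (1%:M - TH)).
        rewrite mulmxBr mulmx1 mul_TH linear_funD// (linear_funN thl) thK.
        by rewrite opprB addrC.
      by split; rewrite /= ?re_mulmx ?im_mulmx q.
    move=> A AaC; rewrite !(complex_bracketE brl brr).
    have ATH : adC br A *m rc TH = - (rc TH *m adC br A).
      have [A1 A2] := AaC; rewrite -(cplxK A) (adC_cplx brl brr).
      rewrite mulmxDl mulmxDr -scalemxAl -scalemxAr !radTH ?scalerN ?opprD//;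
        exact: a_q.
    rewrite !mulmxBl.
    have -> : y *m rc TH *m adC br A *m adC br A = y *m adC br A *m adC br A *m
      rc TH.
      have AATH : adC br A *m adC br A *m rc TH = rc TH *m (adC br A *m adC br A).
        exact: anticomm_sqr.
      by rewrite -[LHS]mulmxA -[LHS]mulmxA -AATH !mulmxA.
    by rewrite alphaP// -!scalemxAl alphaP// -!scalemxAl !scalerA -expr2 -scalerBr.
  (* If the involution fixed [y], its anticommutation with ad X would force [alpha (cplx X 0)] to
     equal its own opposite. *)
  move=> /eqP; rewrite subr_eq0 => /eqP yTH.
  have : alpha (cplx X 0) *: y = - (alpha (cplx X 0) *: y).
    rewrite -alphaR// {1}yTH -mulmxA -[rc TH *m _]opprK -radTH// mulmxN mulmxA
      alphaR//.
    by rewrite -scalemxAl -yTH.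
  move: (alpha (cplx X 0)) aX0 => c c0 /eqP.
  rewrite -addr_eq0 -mulr2n -scaler_nat !scaler_eq0 pnatr_eq0 (negPf c0).
  by rewrite (negPf y0).
- exact/eqP.
- have : (l * alpha (cplx X 0) + alpha (cplx xi_s 0)) *: y = 0.
    by rewrite scalerDl -scalerA -!alphaR// scalemxAr -mulmxDr.
  move=> /eqP; rewrite scaler_eq0 (negPf y0) orbF addr_eq0 => /eqP lE.
  by rewrite -mulNr -lE mulfK.
Qed.

Lemma shape_eigenvalue_of_root (alpha : 'rV[R[i]]_n -> R[i]) :
  complex_root alpha -> alpha (cplx X 0) <> 0 ->
  exists2 z, cplx_set T z /\ z <> 0 &
    cplx_op S z = - (alpha (cplx xi_s 0) / alpha (cplx X 0)) *: z.
Proof.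
move=> [alin _ [Y [YqC YE] /eqP Y0]] /eqP aX0.
have YR A : A \in a -> Y *m rc (ad A) *m rc (ad A) = alpha (cplx A 0) ^+ 2 *: Y.
  move=> Aa; have := YE _ (aC_real Aa).
  by rewrite !(complex_bracketE brl brr) cplx0E (adC_real brl brr).
have qn : th xi_n = - xi_n.
  have -> : xi_n = xi - xi_s by rewrite xiE addrC addKr.
  by rewrite (linear_funD thl) (linear_funN thl) qxi a_q// opprD.
have YTH : Y *m rc TH = - Y.
  have [Y1 Y2] := YqC; rewrite -(cplxK Y) cplx_mulmx !mul_TH Y1 Y2.
  by apply/rowP => j; rewrite !mxE; apply/eqP; rewrite eq_complex /= !eqxx.
(* A root vector only controls squares of ad A; the mixed product comes by polarization, from the
   square for [X + xi_s]. *)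
have YXs : Y *m rc (ad X) *m rc (ad xi_s) =
    (alpha (cplx X 0) * alpha (cplx xi_s 0)) *: Y.
  have cD : cplx (X + xi_s) 0 = 1 *: cplx X 0 + cplx xi_s 0.
    by rewrite scale1r !cplx0E map_mxD.
  have := YR _ (memvD Xa sa); rewrite cD alin; [|exact: aC_real..].
  have -> : rc (ad (X + xi_s)) = rc (ad X) + rc (ad xi_s).
    by rewrite -[X]scale1r adlin !scale1r map_mxD.
  rewrite mul1r !mulmxDr !mulmxDl !YR// -[Y *m rc (ad xi_s) *m _]mulmxA -abs mulmxA.
  move: (Y *m _ *m _) => V /rowP VE; apply/rowP => j; have := VE j; rewrite !mxE.
  move: (alpha _) (alpha _) (Y 0 j) (V 0 j) => q p y v vE.
  have two0 : (2 : R[i]) != 0 by rewrite pnatr_eq0.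
  apply: (mulfI two0).
  have -> : 2 * v = p ^+ 2 * y + v + (v + q ^+ 2 * y) - p ^+ 2 * y - q ^+ 2 * y
    by ring.
  by rewrite vE; ring.
have [z z0 [zM zE]] := eigenvector_of_root_vector abs abn bsn bnk a_ss (radTH
  qX) (radTH qn)
  YTH Y0 aX0 (YR _ Xa) YXs erefl.
have Tz : cplx_set T z by apply/tangentC; rewrite /M map_mxM map_mxD map_mx1.
exists z; first by split=> //; exact/eqP.
by apply/shape_eigenvectorE => //; rewrite adE.
Qed.

End ShapeSpectrum.

(** * The orbit and its shape operator *)

Section SymmetricSpace.
Context {R : realType} {n : nat} {G : topGroupType} {atlas : set (chart R n G)}.
Hypothesis lieG : lie_group atlas.
Context (e : chart R n G).
Hypotheses (ae : atlas e) (e1 : chart_dom e 1%g).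
Context (sigma : G -> G).
Hypothesis invol : lie_involution atlas sigma.

Local Notation x0 := (chart_map e 1%g).
Local Notation psi := (chart_inv e).
Local Notation phi := (chart_map e).
Local Notation th := (diff1 e sigma).
Local Notation br := (bracket e).

Lemma sigmaM g h : sigma (g * h)%g = (sigma g * sigma h)%g.
Proof. by have [_ H _] := invol. Qed.

Lemma sigma1 : sigma 1%g = 1%g.
Proof. by apply: (mulgI (sigma 1%g)); rewrite -sigmaM !mulg1. Qed.

Lemma locally_diff_sigma : locally_diff e sigma.
Proof.
by apply: (locally_diff_smooth lieG ae e1) sigma1; have [] := invol.
Qed.

Lemma diff1_sigma_linear : linear th.
Proof. exact/diff1_linear/locally_diff_sigma. Qed.

Lemma diff1_sigmaK Z : th (th Z) = Z.
Proof.
have Ls := locally_diff_sigma.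
have [_ <-] := locally_diff_comp lieG ae e1 Ls Ls.
rewrite -[RHS](diff1_id lieG ae e1); congr (diff1 e _ Z).
by apply/funext => g; have [_ _ K] := invol; exact: K.
Qed.

Lemma diff1_sigma_bracket Y Z : th (br Y Z) = br (th Y) (th Z).
Proof. exact: (diff1_bracket lieG ae e1 _ _ locally_diff_sigma sigmaM). Qed.

Context (H : set G).
Hypothesis compH : connected_component (fixed_points sigma) 1%g `<=` H.

Lemma subgroup_curve Z : th Z = Z ->
  exists gamma : R -> 'rV[R]_n, [/\ gamma 0 = x0, is_derive (0 : R) 1 gamma Z &
    \forall t \near (0 : R), H (psi (gamma t))].
Proof.
move=> tZ; have Ls := locally_diff_sigma; have [s1 sc sd] := Ls.
pose s := local_rep e sigma.
have sS : smooth_map atlas sigma by have [] := invol.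
have sx0 : s x0 = x0 := local_rep1 lieG ae e1 s1.
have SE v : 'd s x0 v = th v by rewrite (diff1_local_rep _ Ls).
have SS v : 'd s x0 ('d s x0 v) = v by rewrite !SE diff1_sigmaK.
have x0s : chart_dom e (sigma 1%g) by rewrite sigma1.
have [_ strict] := C1_frame_diff frame_rV
  (nbhs_map_chart_dom lieG sS ae ae e1 x0s) (map_chart_smooth sS 1 ae ae).
have strict' (eps : R) : 0 < eps -> exists2 rho : R, 0 < rho &
  forall y z, `|y - x0| < rho -> `|z - x0| < rho ->
    `|s z - s y - 'd s x0 (z - y)| <= eps * `|z - y|.
  move=> /strict[rho rho0 Hr]; exists rho => // y z yr zr.
  by rewrite -deriveE//; exact: Hr.
have dom_s : \forall u \near x0, chart_dom e (sigma (psi u)).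
  exact: (near_chart_dom lieG ae e1).
have cod : \forall u \near x0, chart_codom e u by exact: (near_codom lieG).
have ss : \forall u \near x0, s (s u) = u.
  near=> u; rewrite /s /local_rep (chart_invK lieG)//; last by near: u.
  have [_ _ K] := invol; rewrite K (chart_mapK lieG)//; by near: u.
(* Keeping the curve in this set lets a fixed point of the coordinate map [s] be read back as a
   fixed point of [sigma]. *)
have nU : \forall u \near x0, chart_codom e u /\ chart_dom e (sigma (psi u)).
  by near=> u; split; near: u.
have [gamma [d [d0 g0 dg gP]]] := involution_curve sx0 SS strict' ss nU
  (etrans (SE Z) tZ).
exists gamma; split=> //.
pose I : set R := `]- d, d[%classic.
have ID t : I t -> `|t| < d by rewrite /I/= in_itv/= ltr_norml.
have I0 : I 0 by rewrite /I/= in_itv/= oppr_lt0 d0.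
have fix_ t : I t -> fixed_points sigma (psi (gamma t)).
  move=> /ID/gP[st [_ Ut] _]; rewrite /fixed_points/=.
  by rewrite -[in RHS]st /s /local_rep (chart_invK lieG).
(* This arc is connected, passes through 1 and consists of fixed points, so it lies in the identity
   component of the fixed point group, hence in [H]. *)
have con : connected ((psi \o gamma) @` I).
  apply: connected_continuous_connected.
    by apply/connected_intervalP; exact: interval_is_interval.
  apply: continuous_in_subspaceT => t /set_mem/ID/gP[_ [ct _] gc].
  have [_ /(_ e ae)[_ _ _ _ pc] _ _ _] := lieG.
  exact: continuous_comp gc (pc _ ct).
have sub : (psi \o gamma) @` I `<=` H.
  apply: subset_trans compH; apply: connected_component_max => //.
    by exists 0 => //=; rewrite g0 (chart_inv1 lieG).
  by move=> _ [t It <-]; exact: fix_.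
near=> t; apply: sub; exists t => //.
near: t; apply: open_nbhs_nbhs; split => //; exact: itv_open.
Unshelve. all: by end_near. Qed.

Hypothesis ss : semisimple_algebra e.
Hypotheses (H1 : H 1%g) (Hfix : H `<=` fixed_points sigma).

Let brl := bracket_linearl lieG ae e1.
Let brr := bracket_linearr lieG ae e1.
Let jac := jacobi lieG ae e1.
Let killE Y Z : killing e Y Z = kil br Y Z. Proof. by []. Qed.
Let ssk : forall Y, (forall Z, kil br Y Z = 0) -> Y = 0. Proof. exact: ss. Qed.

Lemma Ad_killing g Y Z : killing e (Ad e g Y) (Ad e g Z) = killing e Y Z.
Proof.
rewrite !killE; apply: (kil_aut brr _ _ (Ad_linear lieG ae e1 g) (g := Ad e
  (g^-1)%g)).
  by move=> W; rewrite -(AdM lieG ae e1) mulgV (Ad1 lieG).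
by move=> U W; exact: (Ad_bracket lieG).
Qed.

Context (r : R) (X xi : 'rV[R]_n).
Hypotheses (r0 : 0 < r) (qX : qq e sigma X)
  (sph : ad_orbit e H X `<=` pseudo_sphere e sigma r)
  (pr : pseudo_riemannian_orbit e sigma H X) (nxi : orbit_normal e sigma X xi).

Let AdX1 : ad_orbit e H X X.
Proof. by exists 1%g => //; exact: (Ad1 lieG). Qed.

Let killXX : killing e X X != 0.
Proof. by have [_ ->] := sph AdX1; rewrite gt_eqF. Qed.

Lemma orbit_tangent_nondeg v : orbit_tangent e sigma X v ->
  (forall w, orbit_tangent e sigma X w -> killing e v w = 0) -> v = 0.
Proof. exact: pr AdX1 v. Qed.

Let brXX : br X X = 0. Proof. exact: (brxx brl brr jac ssk). Qed.

(** The radial correction in [sphere_proj] is a multiple of [X], invisible to the bracket with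
    [X]. *)
Let brNZ c (D w : 'rV[R]_n) : br (D - c *: X + w) X = br D X + br w X.
Proof.
rewrite (linear_funD (brl X)) (linear_funD (brl X)) (linear_funN (brl X)).
by rewrite (linear_funZ (brl X)) brXX scaler0 subr0.
Qed.

(** Differentiating [br (nu t) (gamma t) = 0] gives [br D X + br xi v = 0], while normality of the
    projected [D] plus [w] gives [br D X + br w X = 0]. *)
Lemma shape_rel_bracket v w : shape_rel e sigma H X xi v w ->
  orbit_tangent e sigma X w /\ br w X = br xi v.
Proof.
move=> [gamma [nu [D [[g0 dg] [n0 dn] nr Tw [_ nb _]]]]]; split; first exact: Tw.
have nz : \forall t \near (0 : R), 0 = br (nu t) (gamma t).
  by near=> t; have [_ [_ -> _]] : ad_orbit e H X (gamma t) /\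
    orbit_normal e sigma (gamma t) (nu t) by near: t.
have D1 := is_derive_bilinear brl brr dn dg.
have D0 : is_derive (0 : R) 1 (fun t => br (nu t) (gamma t)) 0.
  exact: near_eq_is_derive nz (is_derive_cst 0 _ _).
have := is_derive_unique D1 D0; rewrite g0 n0 => E.
move: nb; rewrite /sphere_proj brNZ => /eqP; rewrite addrC addr_eq0 => /eqP ->.
by move/eqP: E; rewrite addrC addr_eq0 => /eqP ->.
Unshelve. all: by end_near. Qed.

Lemma shape_rel_exists v : orbit_tangent e sigma X v ->
  exists w, shape_rel e sigma H X xi v w.
Proof.
move=> [Z tZ <-]; have [qxi xiX kxiX] := nxi.
have [c [c0 dc Hc]] := subgroup_curve tZ.
pose D := br Z xi.
(* [w] is minus the tangential part of [D], the derivative at 0 of the transported normal field. *)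
have [w Tw wP] := tangent_projection brl brr jac ssk diff1_sigma_linear
  diff1_sigmaK orbit_tangent_nondeg D.
have qD : th D = - D by rewrite diff1_sigma_bracket tZ qxi (linear_funN (brr Z)).
have qw : th w = - w := tangent_q brr diff1_sigma_bracket qX Tw.
have qDw : th (D + w) = - (D + w) by rewrite (linear_funD diff1_sigma_linear) qD
  qw opprD.
have nDw : br (D + w) X = 0.
  exact: (normal_br brl brr jac ssk diff1_sigma_linear diff1_sigmaK
    diff1_sigma_bracket qX qDw wP).
(* Tangent vectors are orthogonal to [X], so adding [w] leaves the result of [sphere_proj] tangent
   to the sphere. *)
have kwX : kil br w X = 0.
  have [Z' tZ' <-] := Tw.
  rewrite (brC brl brr jac ssk Z' X) (kilNl brl brr) (kil_ad brr jac) brXX.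
  by rewrite kilC -[0](scale0r X) (kilZl brl brr) mul0r !oppr0.
exists w, (fun t => Ad e (psi (c t)) X), (fun t => Ad e (psi (c t)) xi), D.
have A0 W : Ad e (psi (c 0)) W = W by rewrite c0 (chart_inv1 lieG)// (Ad1 lieG).
split.
- by split; [exact: A0|exact: (is_derive_Ad lieG ae e1 X c0 dc)].
- by split; [exact: A0|exact: (is_derive_Ad lieG ae e1 xi c0 dc)].
(* The transported field stays normal: [Ad] of an element of [H] commutes with the involution and
   preserves the bracket and the Killing form. *)
- apply: filterS Hc => t Ht; split; first by exists (psi (c t)).
  split.
  + have := Ad_morph lieG ae e1 (psi (c t)) xi locally_diff_sigma sigmaM.
    have sg : sigma (psi (c t)) = psi (c t) := Hfix Ht.
    rewrite sg qxi (linear_funN (Ad_linear lieG ae e1 _)).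
    exact.
  + rewrite -(Ad_bracket lieG ae e1) xiX.
    have := linear_funZ (Ad_linear lieG ae e1 (psi (c t))) 0 0.
    by rewrite !scale0r.
  + exact: etrans (Ad_killing (psi (c t)) xi X) kxiX.
- exact: Tw.
- rewrite /sphere_proj; split.
  + have qX' : th X = - X := qX.
    rewrite /qq/= addrAC (linear_funD diff1_sigma_linear) (linear_funN
      diff1_sigma_linear).
    by rewrite (linear_funZ diff1_sigma_linear) qDw qX' scalerN [RHS]opprD.
  + by rewrite brNZ -(linear_funD (brl X)).
  + rewrite killE (kilDl brl brr) kwX addr0 (kilDl brl brr) (kilNl brl brr)
    (kilZl brl brr).
    by rewrite -!killE divfK// subrr.
Qed.

(** Since [shape_rel] is inhabited over every tangent vector, [xget] returns a related vector and
    not its default 0. *)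
Lemma shape_opP v : orbit_tangent e sigma X v ->
  orbit_tangent e sigma X (shape_op e sigma H X xi v) /\
  br (shape_op e sigma H X xi v) X = br xi v.
Proof.
move=> Tv; apply: shape_rel_bracket.
by have [w wP] := shape_rel_exists Tv; exact: (xgetPex 0 (ex_intro _ w wP)).
Qed.

End SymmetricSpace.

(** * The spectrum formula, by two inclusions *)

Theorem corollary2p5 (R : realType) (n : nat) (G : topGroupType)
    (atlas : set (chart R n G)) (e : chart R n G)
    (sigma : G -> G) (H : set G)
    (r : R) (X xi xi_s xi_n : 'rV[R]_n) (a : {vspace 'rV[R]_n}) :
  lie_group atlas -> atlas e -> chart_dom e 1%g ->
  connected [set: G] -> ~ compact [set: G] -> semisimple_algebra e ->
  lie_involution atlas sigma ->
  closed_subgroup H ->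
  connected_component (fixed_points sigma) 1%g `<=` H ->
  H `<=` fixed_points sigma ->
  0 < r -> qq e sigma X ->
  ad_orbit e H X `<=` pseudo_sphere e sigma r ->
  pseudo_riemannian_orbit e sigma H X ->
  orbit_normal e sigma X xi ->
  jordan_chevalley e xi xi_s xi_n ->
  cartan_subspace e sigma a -> X \in a -> xi_s \in a ->
  shape_spectrum e sigma H X xi =
    [set - (alpha (cplx xi_s 0) / alpha (cplx X 0)) | alpha in
       [set alpha | restricted_root e sigma a alpha /\ alpha (cplx X 0) <> 0]].
Proof.
move=> lieG ae e1 _ _ ss invol [_ H1 _ _] compH Hfix r0 qX sph pr nxi.
move=> [xiE _ [k xi_nk] xi_sn] [[a_q a_ab a_ss] _] Xa sa.
have brl := bracket_linearl lieG ae e1.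
have brr := bracket_linearr lieG ae e1.
have jac := jacobi lieG ae e1.
have [qxi xiX _] := nxi.
have tnd := orbit_tangent_nondeg lieG ae e1 H1 pr.
have shp := @shape_opP R n G atlas lieG e ae e1 sigma invol H compH ss H1 Hfix r
  X xi
  r0 qX sph pr nxi.
have thl := diff1_sigma_linear lieG ae e1 invol.
have thK := diff1_sigmaK lieG ae e1 invol.
have thbr := diff1_sigma_bracket lieG ae e1 invol.
apply/seteqP; split=> [l [z [Tz z0] zE]|_ [alpha [ra aX] <-]].
  have [alpha [ra aX aE]] := root_of_shape_eigenvalue brl brr jac ss thl thK
    thbr qX tnd
    shp xiE xiX (a_ss _ Xa) xi_nk xi_sn a_q a_ab Xa sa Tz z0 zE.
  by exists alpha.
exact: (shape_eigenvalue_of_root brl brr jac ss thl thK thbr qX tnd shp xiE qxi xiX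
  (a_ss _ Xa) xi_nk xi_sn a_q a_ab Xa sa ra aX).
Qed.
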